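(* For $d\ge2$, there exists a monotone property with width $\delta(n,\varepsilon)=\Omega\left((\log\varepsilon^{-1})^{1/d}n^{-1/d}\right)$. For $d=1$, there exists a monotone property with width $\delta(n,\varepsilon)=\Omega\left(\sqrt{\log\varepsilon^{-1}}/\sqrt{n}\right)$.
   Context: Random geometric graph: $G(\mathcal{X}_n;r)$ denotes the random graph whose vertices are $n$ points distributed independently and uniformly in the unit cube $[0,1]^d$, two points being connected iff their Euclidean distance is at most $r$. A graph property is a set $A$ of undirected and unlabelled graphs. It is increasing if whenever $G\in A$, $V(G')=V(G)$ and $E(G)\subseteq E(G')$, also $G'\in A$. A property $A$ is monotone if either $A$ or its complement $A^c$ is increasing; without loss of generality, ''monotone property'' is taken to mean increasing property. For an increasing property $A$, let $r(n,\varepsilon)=\inf\{r>0:\mathbb{P}\{G(\mathcal{X}_n;r)\in A\}\ge\varepsilon\}$ for $0<\varepsilon<1$. For $0<\varepsilon<1/2$, the (threshold) width of $A$ is $\delta(n,\varepsilon)=r(n,1-\varepsilon)-r(n,\varepsilon)$. *)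

(* Defs.v *)
From HB Require Import structures.
From mathcomp Require Import all_boot all_order all_algebra perm.
From mathcomp Require Import all_classical all_reals all_analysis.

Set Implicit Arguments.
Unset Strict Implicit.
Unset Printing Implicit Defensive.

Import Order.TTheory GRing.Theory Num.Theory.
Import numFieldNormedType.Exports.

Local Open Scope classical_set_scope.
Local Open Scope ring_scope.

Record sgraph (n : nat) := SGraph {
  adj : rel 'I_n;
  adj_sym : symmetric adj;
  adj_irr : irreflexive adj }.

Definition sgraph_iso n (G H : sgraph n) :=
  exists s : {perm 'I_n}, forall i j, adj H (s i) (s j) = adj G i j.

(* A set of unlabelled graphs is encoded as a family, indexed by the number of
   vertices, of isomorphism-invariant sets of labelled graphs on 'I_n. *)
Record graph_property := GraphProperty {
  gp_set :> forall n, set (sgraph n);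
  gp_iso : forall n (G H : sgraph n),
    sgraph_iso G H -> gp_set G -> gp_set H }.

Definition increasing (A : graph_property) :=
  forall n (G G' : sgraph n),
    (forall i j, adj G i j -> adj G' i j) -> A n G -> A n G'.

Section IidTuple.
Local Open Scope ereal_scope.
Context {d} {T : measurableType d} {R : realType}.

Section Step.
Variables (k : nat) (P : probability T R) (Q : probability (k.-tuple T) R).

Definition tuple_cons (x : T * k.-tuple T) : k.+1.-tuple T := [tuple of x.1 :: x.2].

Lemma measurable_tuple_cons : measurable_fun [set: T * k.-tuple T] tuple_cons.
Proof. exact: (measurable_cons measurable_fst measurable_snd). Qed.

HB.instance Definition _ :=
  isMeasurableFun.Build _ _ _ _ tuple_cons measurable_tuple_cons.

Definition prob_cons : probability (k.+1.-tuple T) R :=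
  distribution (P \x Q) tuple_cons.

End Step.

(* The law of k independent random elements of law P: the k-fold product of P
   on the product sigma-algebra of k.-tuple T (see iid_prob_box). *)
Fixpoint iid_prob (P : probability T R) (k : nat) : probability (k.-tuple T) R :=
  if k is k'.+1 then prob_cons P (iid_prob P k') else \d_([tuple] : 0.-tuple T).

Lemma iid_prob_box (P : probability T R) k (B : 'I_k -> set T) :
  (forall i, measurable (B i)) ->
  iid_prob P k [set x | forall i, B i (tnth x i)] = \prod_(i < k) P (B i).
Proof.
elim: k B => [|k IH] B mB.
  rewrite big_ord0 /= /dirac indicE mem_set//=.
  by case.
have mbox : measurable
    [set x : k.-tuple T | forall i, B (lift ord0 i) (tnth x i)].
  rewrite (_ : [set x | _] =
    \big[setI/setT]_(i < k) ((@tnth _ T ^~ i) @^-1` B (lift ord0 i))).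
    apply: bigsetI_measurable => i _; rewrite -[X in measurable X]setTI.
    exact: measurable_tnth.
  rewrite -bigcap_seq; apply/seteqP; split => x /= xB i.
    by move=> _; exact: xB.
  by apply: (xB i); rewrite /= mem_index_enum.
rewrite big_ord_recl -IH; last by move=> i; exact: mB.
rewrite -product_measure1E//= /distribution /pushforward; congr (_ _).
apply/seteqP; split => -[x y] /= xyB.
  by split => [|i]; [exact: (xyB ord0)|have := xyB (lift ord0 i); rewrite tnthS].
move=> i; case: xyB => Bx By.
by case: (unliftP ord0 i) => [j|] ->; rewrite ?tnthS.
Qed.

End IidTuple.

Section RandomGeometricGraph.
Variable R : realType.

(* Law of n independent uniform points of the unit cube [0, 1]^d, a point being
   the tuple of its coordinates, themselves independent and uniform on [0, 1]. *)
Definition uniform_cube (d : nat) : probability (d.-tuple (measurableTypeR R)) R :=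
  iid_prob (uniform_prob (@ltr01 R)) d.

Definition points_law (d n : nat) :
    probability (n.-tuple (d.-tuple (measurableTypeR R))) R :=
  iid_prob (uniform_cube d) n.

Definition eucl_dist d (x y : d.-tuple R) : R :=
  Num.sqrt (\sum_(k < d) (tnth x k - tnth y k) ^+ 2).

Lemma eucl_distC d (x y : d.-tuple R) : eucl_dist x y = eucl_dist y x.
Proof.
by rewrite /eucl_dist; congr Num.sqrt; apply: eq_bigr => k _; rewrite -sqrrN opprB.
Qed.

Section Geom.
Variables (d n : nat) (x : n.-tuple (d.-tuple R)) (r : R).

Definition geom_adj : rel 'I_n :=
  fun i j => (i != j) && (eucl_dist (tnth x i) (tnth x j) <= r).

Lemma geom_adj_sym : symmetric geom_adj.
Proof. by move=> i j; rewrite /geom_adj eq_sym eucl_distC. Qed.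

Lemma geom_adj_irr : irreflexive geom_adj.
Proof. by move=> i; rewrite /geom_adj eqxx. Qed.

Definition geom_graph : sgraph n := SGraph geom_adj_sym geom_adj_irr.

End Geom.

Definition threshold (d : nat) (A : graph_property) (n : nat) (eps : R) : R :=
  inf [set r : R | 0 < r /\
    (eps%:E <= points_law d n [set x | A n (geom_graph x r)])%E].

Definition width (d : nat) (A : graph_property) (n : nat) (eps : R) : R :=
  threshold d A n (1 - eps) - threshold d A n eps.

(* delta(n, eps) = Omega(f n eps): n tends to infinity for each fixed eps, and
   the implied constant depends on neither n nor eps.  It is uniform in
   eps on each ]0, eps0] with eps0 < 1/2, but may degrade as eps0 tends to 1/2:
   for fixed n the width tends to 0 as eps tends to 1/2 whereas ln eps^-1 does
   not. *)
Definition width_Omega (d : nat) (A : graph_property) (f : nat -> R -> R) :=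
  forall eps0 : R, 0 < eps0 < 2^-1 ->
  exists2 c : R, 0 < c &
    forall eps : R, 0 < eps <= eps0 ->
      \forall n \near \oo, c * f n eps <= width d A n eps.

End RandomGeometricGraph.

(* Main.v *)
From mathcomp Require Import all_analysis.
From mathcomp Require Import lra zify.
Require Import Defs.
From HB Require Import structures.
From mathcomp Require Import all_boot all_order all_algebra.
From mathcomp Require Import all_classical all_reals all_analysis.
From mathcomp Require Import perm measurable_realfun.

(** A single property serves every dimension from 2 on: being complete. The
    graph of radius r is complete iff the diameter of the sample is at most r,
    and distances close to the length D = sqrt d of the diagonals only occur
    between points near opposite corners, where the sample has the spacing
    nu = n^(-1/d).

    - If t = c (ln 1/eps)^(1/d) nu with c small, then with probability at
      least eps no point lies within O(t) of a corner, and the diameter is at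
      most D - t ([prob_complete_ge], [complete_threshold_le]).
    - For K large, two opposite corners have with high probability a point at
      distance O(K nu), and the diameter exceeds D - K nu
      ([prob_complete_le], [complete_upper_tail]).

    When eps is small the first shift dominates the second, which does not
    depend on eps, and the width is of order (ln 1/eps)^(1/d) nu. The remaining
    eps range over a compact part of ]0, 1/2[, where it is enough to bound
    below the width at eps0, as the width decreases in eps. There one needs
    that the law of the diameter is spread out at scale nu: a radius window of
    length h = delta nu contains a distance with probability at most the
    expected number of pairs at such a distance, which is
    O(n^2 nu^(2 d - 1) h) = O(delta) because both points are confined to
    corner boxes of side O(nu) and, all coordinates but one being fixed, the
    last one ranges over intervals of length O(h)
    ([prob_complete_increment]). So the distribution function of the diameter
    cannot climb from eps0 to 1 - eps0 within a window with delta small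
    ([complete_width_ge]).

    On the segment, fluctuations of order 1 / sqrt n come from counting a
    positive fraction of the points. The property is that more than half of
    the vertices are adjacent to all the others. For r above 1/2 a vertex of
    [1 - r, r] is dominating, and conversely a dominating vertex lies in
    [1 - r - s, r + s] as soon as each end of the segment has a point within
    s. The probability of the property is thus that of a majority of successes
    among n trials of success probability 2 r - 1, up to a shift s that may
    be any fraction of 1 / sqrt n
    ([prob_majority_dominating_ge], [prob_majority_dominating_le]). At
    r = 3/4 the trials are fair. Moving r down by an amount of order
    t / sqrt n still leaves, by comparison with fair trials, a probability of
    nearly exp (- O(t + t^2)) / 2 ([majority_tail]), and this exceeds eps for
    t = c sqrt (ln 1/eps): the loss of a factor close to 2 is affordable
    precisely since eps0 < 1/2.
    Moving r up is the mirror image of it. *)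

Set Implicit Arguments.
Unset Strict Implicit.
Unset Printing Implicit Defensive.

Import Order.TTheory GRing.Theory Num.Theory.
Import numFieldNormedType.Exports.

Local Open Scope classical_set_scope.
Local Open Scope ring_scope.

(** * Probability on finite products *)

Lemma measurable_forall_fin d (T : measurableType d) (I : finType)
    (E : I -> set T) :
  (forall i, measurable (E i)) -> measurable [set x | forall i, E i x].
Proof.
move=> mE.
rewrite (_ : [set x | _] = \big[setI/setT]_(i : I) E i).
  by apply: bigsetI_measurable => i _; exact: mE.
rewrite -bigcap_seq; apply/seteqP; split => x /= xE i; first by move=> _;
  exact: xE.
by apply: xE; rewrite /= mem_index_enum.
Qed.

Lemma measurable_exists_fin d (T : measurableType d) (I : finType)
    (E : I -> set T) :
  (forall i, measurable (E i)) -> measurable [set x | exists i, E i x].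
Proof.
move=> mE.
rewrite (_ : [set x | _] = ~` [set x | forall i, (~` E i) x]).
  by apply/measurableC/measurable_forall_fin => i; exact: measurableC.
apply/seteqP; split => x /=; first by move=> [i Eix] /(_ i).
by move=> /existsNP[i /contrapT]; exists i.
Qed.

Lemma measurable_coord d (T : measurableType d) k (i : 'I_k) (B : set T) :
  measurable B -> measurable [set x : k.-tuple T | B (tnth x i)].
Proof.
by move=> mB; rewrite -[X in measurable X]setTI; exact: measurable_tnth.
Qed.

Lemma measurable_box d (T : measurableType d) k (B : 'I_k -> set T) :
  (forall i, measurable (B i)) ->
  measurable [set x : k.-tuple T | forall i, B i (tnth x i)].
Proof. by move=> mB; apply: measurable_forall_fin => i;
  exact: measurable_coord. Qed.

Definition tuple_pow T k (B : set T) : set (k.-tuple T) :=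
  [set x | forall i, B (tnth x i)].
Arguments tuple_pow {T} k B.

Lemma measurable_tuple_pow d (T : measurableType d) k (B : set T) :
  measurable B -> measurable (tuple_pow k B).
Proof. by move=> mB; exact: (@measurable_box _ _ k (fun=> B)). Qed.

Section Probability.
Context d (T : measurableType d) (R : realType).
Implicit Types P : probability T R.

Lemma iid_prob_pow P k (B : set T) (p : R) : measurable B -> P B = p%:E ->
  iid_prob P k (tuple_pow k B) = (p ^+ k)%:E.
Proof.
move=> mB PB; rewrite (@iid_prob_box _ _ _ P k (fun=> B))//.
by rewrite big_const_ord PB; elim: k => //= k ->; rewrite exprS EFinM.
Qed.

Lemma le_prob P (A B : set T) : measurable A -> measurable B -> A `<=` B ->
  (P A <= P B)%E.
Proof. by move=> mA mB AB; apply: le_measure; rewrite ?inE. Qed.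

(** The union bound. *)
Lemma prob_exists_fin P (I : finType) (E : I -> set T) (D : set T) (b : R) :
  measurable D -> (forall i, measurable (E i)) ->
  (forall x, D x -> exists i, E i x) -> (forall i, (P (E i) <= b%:E)%E) ->
  (P D <= (#|I|%:R * b)%:E)%E.
Proof.
move=> mD mE DE PE.
(* subadditivity is about sequences: E is enumerated and padded with set0 *)
pose F k := if insub k is Some j then E (enum_val (j : 'I_#|I|)) else set0.
have mF k : measurable (F k) by rewrite /F; case: insubP.
have PF k : (k < #|I|)%N -> (P (F k) <= b%:E)%E.
  by rewrite /F; case: insubP => [j _ _ _|/negbTE->//]; exact: PE.
apply: (@le_trans _ _ (\sum_(k < #|I|) P (F k))%E).
  apply: content_subadditive => //.
  move=> x /DE[i Eix]; rewrite -bigcup_mkord; exists (enum_rank i) => /=;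
    first exact: ltn_ord.
  by rewrite /F; case: insubP => [j _ /val_inj->|];
    rewrite ?ltn_ord// enum_rankK.
apply: (@le_trans _ _ (\sum_(k < #|I|) b%:E)%E).
  by apply: lee_sum => k _; exact: PF.
by rewrite sumEFin sumr_const card_ord mulr_natl.
Qed.

Lemma measurable_coord_pair n (i j : 'I_n) :
  measurable_fun setT (fun x : n.-tuple T => (tnth x i, tnth x j)).
Proof. by apply: measurable_fun_pair; exact: measurable_tnth. Qed.

(** Two distinct entries of an iid tuple are independent: both sides agree on
    rectangles, which determine a product measure. *)
Lemma iid_prob_pair P n (i j : 'I_n) (E : set (T * T)) : i != j ->
  measurable E ->
  iid_prob P n [set x | E (tnth x i, tnth x j)] = (P \x P)%E E.
Proof.
move=> ij mE; pose f := mfun_Sub (mem_set (measurable_coord_pair i j)).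
rewrite (product_measure_unique (m' := distribution (iid_prob P n) f))//.
move=> A B mA mB.
rewrite /distribution /pushforward/=.
pose C k := if k == i then A else if k == j then B else setT.
transitivity (iid_prob P n [set x | forall k, C k (tnth x k)]).
  congr (iid_prob P n _); apply/seteqP; split => x /=.
    by move=> [Ax Bx] k; rewrite /C; case: eqP => [->//|_]; case: eqP => [->|].
  by move=> Cx; have := Cx i; have := Cx j; rewrite /C eq_sym (negbTE ij) !eqxx.
rewrite iid_prob_box => [|k]; last by rewrite /C; do 2 case: ifP => //.
rewrite (bigD1 i)//= (bigD1 j) 1?eq_sym//= /C eqxx eq_sym (negbTE ij) eqxx.
rewrite big1 ?mule1// => k /andP[/negbTE-> /negbTE->]; exact: probability_setT.
Qed.

End Probability.

(** Fubini, in the only form needed: a set whose sections have probability at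
    most b, and which lies above D, has probability at most b times that of
    D. *)
Lemma product_prob_le d1 d2 (T1 : measurableType d1) (T2 : measurableType d2)
    (R : realType) (P1 : probability T1 R) (P2 : probability T2 R)
    (E : set (T1 * T2)) (D : set T2) (b : R) :
  0 <= b -> measurable E -> measurable D ->
  (forall x y, E (x, y) -> D y) ->
  (forall y, D y -> (P1 [set x | E (x, y)] <= b%:E)%E) ->
  ((P1 \x P2) E <= b%:E * P2 D)%E.
Proof.
move=> b0 mE mD ED PE.
rewrite (product_measure_unique (m' := (P1 \x^ P2)%E))//; last first.
  by move=> A B mA mB; exact: product_measure2E.
rewrite /product_measure2.
apply: (@le_trans _ _ (\int[P2]_y (b%:E * (\1_D y)%:E))%E); last first.
  rewrite ge0_integralZl//; last exact/measurable_EFinP/measurable_indic.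
  by rewrite integral_indic// setIT.
apply: ge0_le_integral => //=.
- exact: measurable_fun_ysection.
- by apply: measurable_funeM; exact/measurable_EFinP/measurable_indic.
- move=> y _; rewrite indicE; case: (boolP (y \in D)) => [/set_mem Dy|yD].
    by rewrite mule1; rewrite (_ : ysection E y = [set x | E (x, y)]) ?PE//;
       apply/seteqP; split => x; rewrite /ysection/= inE.
  rewrite mule0 (_ : ysection E y = set0) ?measure0//.
  apply/seteqP; split => x//; rewrite /ysection/= inE => /ED.
  by move: yD; rewrite notin_setE.
Qed.

Lemma iid_prob_consE d (T : measurableType d) (R : realType)
    (P : probability T R) k (E : set (k.+1.-tuple T)) : measurable E ->
  iid_prob P k.+1 E = (P \x iid_prob P k)%E [set z | E (tuple_cons z)].
Proof. by []. Qed.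

(** * The uniform law, graph events and thresholds *)

Lemma itvccP (R : realType) (a b x : R) :
  `[a, b]%classic x -> a <= x /\ x <= b.
Proof. by rewrite /= in_itv/= => /andP. Qed.

Section Uniform.
Variable R : realType.
Notation U := (uniform_prob (@ltr01 R)).

Lemma uniform01E (A : set (measurableTypeR R)) : measurable A ->
  U A = lebesgue_measure (A `&` `[0, 1]%classic).
Proof.
move=> mA; rewrite /uniform_prob integral_uniform_pdf.
rewrite (eq_integral (cst 1%:E)); last first.
  by move=> x /set_mem[_ /=]; rewrite in_itv/= /uniform_pdf => ->;
    rewrite subr0 invr1.
by rewrite integral_cst ?mul1e//; exact: measurableI.
Qed.

Lemma uniform01_itv (a b : R) : 0 <= a -> a <= b -> b <= 1 ->
  U `[a, b]%classic = (b - a)%:E.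
Proof.
move=> a0 ab b1; rewrite uniform01E// setIidl; last first.
  by move=> x/=; rewrite !in_itv/= => /andP[ax xb]; apply/andP; split; lra.
rewrite lebesgue_measure_itv/= lte_fin.
by case: ltgtP ab => // ->; rewrite subrr.
Qed.

Lemma uniform01_01 : U `[0, 1]%classic = 1%:E.
Proof. by rewrite uniform01_itv// subr0. Qed.

Lemma uniform01_le (a b : R) : a <= b -> (U `[a, b]%classic <= (b - a)%:E)%E.
Proof.
move=> ab; rewrite uniform01E//.
apply: (@le_trans _ _ (lebesgue_measure (`[a, b]%classic : set R))).
  apply: le_measure; rewrite ?inE//; first exact: measurableI.
rewrite lebesgue_measure_itv/= lte_fin; by case: ltgtP ab => // ->;
  rewrite subrr.
Qed.

(** A set of diameter l lies in an interval of length 2 l around any of its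
    points. *)
Lemma uniform01_diam (A : set (measurableTypeR R)) (l : R) :
  measurable A -> 0 <= l -> (forall x y, A x -> A y -> x - y <= l) ->
  (U A <= (2 * l)%:E)%E.
Proof.
move=> mA l0 Al.
have [->|/set0P[p Ap]] := eqVneq A set0.
  by rewrite measure0 lee_fin; lra.
apply: (@le_trans _ _ (U `[p - l, p + l]%classic)).
  apply: le_prob => // x Ax /=; rewrite in_itv/=.
  by have := Al _ _ Ax Ap; have := Al _ _ Ap Ax => *; apply/andP; split; lra.
by apply: le_trans (uniform01_le _) _; rewrite ?lee_fin; lra.
Qed.

End Uniform.

Section GraphEvents.
Variable R : realType.

Lemma eucl_dist_ge0 d (x y : d.-tuple R) : 0 <= eucl_dist x y.
Proof. exact: sqrtr_ge0. Qed.

Lemma sqr_eucl_dist d (x y : d.-tuple R) :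
  eucl_dist x y ^+ 2 = \sum_(k < d) (tnth x k - tnth y k) ^+ 2.
Proof. by rewrite sqr_sqrtr//; apply: sumr_ge0 => k _; exact: sqr_ge0. Qed.

Lemma measurable_eucl_dist_le d (r : R) :
  measurable [set z : d.-tuple (measurableTypeR R) * d.-tuple (measurableTypeR
    R) |
    eucl_dist z.1 z.2 <= r].
Proof.
have [r0|r0] := leP 0 r; last first.
  rewrite (_ : [set x | _] = set0)//; apply/seteqP; split => x //=.
  by rewrite leNgt => /negP[]; rewrite (lt_le_trans r0)// eucl_dist_ge0.
pose f (z : d.-tuple (measurableTypeR R) * d.-tuple (measurableTypeR R)) : R :=
  \sum_(k < d) (tnth z.1 k - tnth z.2 k) ^+ 2.
have mf : measurable_fun setT f.
  have mt (k : 'I_d) := measurable_tnth (T := measurableTypeR R) k.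
  apply: measurable_sum => k; apply: measurable_funX; apply: measurable_funB.
    exact: measurableT_comp (mt k) measurable_fst.
  exact: measurableT_comp (mt k) measurable_snd.
rewrite (_ : [set x | _] = setT `&` f @^-1` `]-oo, r ^+ 2]%classic);
  first exact: mf.
rewrite setTI; apply/seteqP; split => z /=; rewrite in_itv/= /f -sqr_eucl_dist;
  by rewrite ler_sqr// nnegrE eucl_dist_ge0.
Qed.

Lemma measurable_dist_le d n (i j : 'I_n) (r : R) :
  measurable [set x : n.-tuple (d.-tuple (measurableTypeR R)) |
    eucl_dist (tnth x i) (tnth x j) <= r].
Proof.
rewrite -[X in measurable X]setTI.
exact: (@measurable_coord_pair _ _ n i j) (measurable_eucl_dist_le r).
Qed.

(** Isomorphism invariance along the identity makes a property depend on the
    adjacency relation alone. *)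
Lemma graph_property_ext (A : graph_property) n (G H : sgraph n) :
  (forall i j, adj H i j = adj G i j) -> A n G -> A n H.
Proof. by move=> GH; apply: gp_iso; exists 1%g => i j; rewrite !perm1. Qed.

(** The event is a union over the finitely many adjacency patterns, and each
    pattern is a finite intersection of conditions on single distances. *)
Lemma measurable_geom_graph d (A : graph_property) n (r : R) :
  measurable [set x : n.-tuple (d.-tuple (measurableTypeR R)) |
    A n (geom_graph x r)].
Proof.
pose adjs (x : n.-tuple (d.-tuple (measurableTypeR R))) (p : 'I_n * 'I_n) :=
  geom_adj x r p.1 p.2.
have madj p b : measurable [set x | adjs x p = b].
  have mt : measurable [set x | adjs x p].
    rewrite /adjs /geom_adj; case: eqP => _ /=; last exact: measurable_dist_le.
    by rewrite (_ : [set x | _] = set0)//; apply/seteqP; split.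
  case: b => //; rewrite (_ : [set x | _] = ~` [set x | adjs x p]).
    exact: measurableC.
  by apply/seteqP; split => x /=; [move=> ->|move/negP/negbTE].
pose E (g : {ffun 'I_n * 'I_n -> bool}) :=
  [set x | (forall p, adjs x p = g p) /\
    exists y, (forall p, adjs y p = g p) /\ A n (geom_graph y r)].
rewrite (_ : [set x | _] = [set x | exists g, E g x]).
  apply: measurable_exists_fin => g.
  have [Ag|NAg] := pselect (exists y, (forall p, adjs y p = g p) /\ A n
    (geom_graph y r)).
    rewrite (_ : E g = [set x | forall p, adjs x p = g p]).
      by apply: measurable_forall_fin => p; exact: madj.
    by apply/seteqP; split => x /=; [case|].
  by rewrite (_ : E g = set0)//; apply/seteqP; split => x //= -[].
apply/seteqP; split => x /=.
  move=> Ax; exists [ffun p => adjs x p]; split => [p|]; first by rewrite ffunE.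
  by exists x; split => // p; rewrite ffunE.
move=> [g [xg [y [yg Ay]]]]; apply: graph_property_ext Ay => i j /=.
by have := xg (i, j); have := yg (i, j); rewrite /adjs /= => -> ->.
Qed.

End GraphEvents.

Section Threshold.
Variables (R : realType) (d n : nat) (A : graph_property).
Notation F r := (points_law R d n [set x | A n (geom_graph x r)]).

Lemma threshold_le (eps r : R) : 0 < r -> (eps%:E <= F r)%E ->
  threshold d A n eps <= r.
Proof. by move=> r0 Fr; apply: ge_inf => //; exists 0 => x /= [/ltW]. Qed.

Hypothesis incA : increasing A.

Lemma le_graph_prob (r s : R) : r <= s -> (F r <= F s)%E.
Proof.
move=> rs; apply: le_prob; [exact: measurable_geom_graph..|].
move=> x /=; apply: incA => i j /=;
  rewrite /geom_adj => /andP[-> /=] /le_trans; exact.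
Qed.

Lemma le_threshold (eps r s : R) : 0 < s -> (eps%:E <= F s)%E ->
  (F r < eps%:E)%E -> r <= threshold d A n eps.
Proof.
move=> s0 Fs Fr; apply: lb_le_inf; first by exists s.
move=> t /= [_ Ft]; rewrite leNgt; apply/negP => tr.
by have := lt_le_trans Fr Ft; rewrite ltNge le_graph_prob// ltW.
Qed.

Lemma threshold_mono (eps eps' s : R) : 0 < s -> (eps'%:E <= F s)%E ->
  eps <= eps' -> threshold d A n eps <= threshold d A n eps'.
Proof.
move=> s0 Fs ee; apply: lb_le_inf; first by exists s.
move=> t /= [t0 Ft]; apply: threshold_le => //.
by apply: le_trans Ft; rewrite lee_fin.
Qed.

End Threshold.

(** Inclusion of events may be checked on an almost sure event; it is applied
    with the event [in_cube], where the geometry takes place. *)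
Lemma le_prob_ae d (T : measurableType d) (R : realType) (P : probability T R)
    (A B C : set T) : measurable A -> measurable B -> measurable C ->
  P B = 1%:E -> A `&` B `<=` C -> (P A <= P C)%E.
Proof.
move=> mA mB mC PB ABC.
apply: (@le_trans _ _ (P (C `|` ~` B))).
  apply: le_prob => //; first by apply: measurableU => //; exact: measurableC.
  by move=> x Ax; case: (pselect (B x)) => Bx; [left; exact: ABC|right].
apply: le_trans (measureU2 _ _ _) _ => //; first exact: measurableC.
by rewrite [X in (_ + X)%E]probability_setC// PB subee// adde0.
Qed.

Definition in_cube (R : realType) d n : set (n.-tuple (d.-tuple
  (measurableTypeR R))) :=
  tuple_pow n (tuple_pow d `[0, 1]%classic).

Lemma measurable_in_cube (R : realType) d n : measurable (@in_cube R d n).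
Proof. by do 2 apply: measurable_tuple_pow. Qed.

Lemma prob_in_cube (R : realType) d n : points_law R d n (@in_cube R d n) =
  1%:E.
Proof.
rewrite /points_law (@iid_prob_pow _ _ _ _ _ _ 1) ?expr1n//;
  first exact: measurable_tuple_pow.
by rewrite /uniform_cube (@iid_prob_pow _ _ _ _ _ _ 1) ?expr1n//;
  exact: uniform01_01.
Qed.

(** * Nearly antipodal points of the cube *)

Section Corners.
Variables (R : realType) (d : nat).
Implicit Types x y : d.-tuple R.
Notation D := (Num.sqrt (d%:R : R)).
Notation cube := (tuple_pow d (`[0, 1]%classic : set R)).

(** The part of [0, 1] close to an end point; its d-fold power is the
    neighbourhood of the corners of the cube. *)
Definition ends (s : R) : set R :=
  `[0, s]%classic `|` `[1 - s, 1]%classic.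

Lemma sqr_sqrtn : D ^+ 2 = d%:R.
Proof. by rewrite sqr_sqrtr. Qed.

Lemma cube_coord_dist x y k : cube x -> cube y ->
  `|tnth x k - tnth y k| <= 1.
Proof.
move=> /(_ k)/itvccP[? ?] /(_ k)/itvccP[? ?].
by rewrite ler_norml; apply/andP; split; lra.
Qed.

Lemma cube_dist_le x y : cube x -> cube y -> eucl_dist x y <= D.
Proof.
move=> cx cy; rewrite /eucl_dist ler_wsqrtr//.
rewrite -[leRHS]mulr1 mulr_natl -[X in _ *+ X]card_ord -sumr_const.
by apply: ler_sum => k _;
  rewrite -real_normK ?num_real// expr_le1// cube_coord_dist.
Qed.

(** The squares of the other coordinate differences are at most 1, so none of
    the d differences may fall much short of 1 if the sum of their squares is
    almost d. The bound on that sum comes from (dist - D)^2 >= 0, which is the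
    linearisation of dist^2 at D. *)
Lemma far_coord x y (t : R) k : cube x -> cube y ->
  D - t < eucl_dist x y -> 1 - 2 * D * t < `|tnth x k - tnth y k|.
Proof.
move=> cx cy far.
have D0 : 0 < D by rewrite sqrtr_gt0 ltr0n (leq_ltn_trans _ (ltn_ord k)).
have h1 : d%:R - 2 * D * t < eucl_dist x y ^+ 2.
  have := sqr_ge0 (eucl_dist x y - D); have := sqr_sqrtn.
  by move: far; rewrite -subr_gt0 => /(mulr_gt0 D0); nra.
have c1 := cube_coord_dist k cx cy.
have h2 : eucl_dist x y ^+ 2 <= (d%:R - 1) + (tnth x k - tnth y k) ^+ 2.
  rewrite sqr_eucl_dist (bigD1 k)//= addrC lerD2r.
  apply: (@le_trans _ _ (\sum_(i < d | i != k) 1)).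
    by apply: ler_sum => i _;
      rewrite -real_normK ?num_real// expr_le1// cube_coord_dist.
  rewrite sumr_const (_ : #|_| = d.-1); last first.
    by have := cardC1 k; rewrite card_ord => <-; apply: eq_card.
  by case: d k {c1 far h1 cx cy x y D0} => [[]//|d' _]; rewrite /= -natr1 addrK.
have w2 : (tnth x k - tnth y k) ^+ 2 <= `|tnth x k - tnth y k|.
  by rewrite -real_normK ?num_real// expr2 ler_piMl.
lra.
Qed.

Lemma far_ends x y (t : R) : cube x -> cube y ->
  D - t < eucl_dist x y -> tuple_pow d (ends (2 * D * t)) x.
Proof.
move=> cx cy far k; have := far_coord k cx cy far.
have [? ?] := itvccP (cx k); have [? ?] := itvccP (cy k).
rewrite lter_normr => /orP[?|?]; [right|left]; rewrite /= in_itv/=;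
  apply/andP; split; lra.
Qed.

Lemma opposite_corners_dist x y (s : R) : s <= 2^-1 ->
  tuple_pow d `[0, s]%classic x -> tuple_pow d `[1 - s, 1]%classic y ->
  D * (1 - 2 * s) <= eucl_dist x y.
Proof.
move=> s1 xs ys.
rewrite -(@ler_sqr _ (D * _)) ?nnegrE ?eucl_dist_ge0//; last first.
  by rewrite mulr_ge0 ?sqrtr_ge0//; lra.
rewrite sqr_eucl_dist exprMn sqr_sqrtn.
have -> c : d%:R * c = \sum_(k < d) c :> R
  by rewrite sumr_const card_ord mulr_natl.
apply: ler_sum => k _; have [? ?] := itvccP (xs k); have [? ?] := itvccP (ys k).
by rewrite -[leRHS]sqrrN opprB ler_sqr ?nnegrE; lra.
Qed.

Lemma measurable_ends (s : R) : measurable (ends s).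
Proof. exact: measurableU. Qed.

Lemma prob_ends (s : R) : 0 <= s ->
  exists2 u : R, uniform_prob (@ltr01 R) (ends s) = u%:E & 0 <= u <= 2 * s.
Proof.
move=> s0.
have le2s : (uniform_prob (@ltr01 R) (ends s) <= (2 * s)%:E)%E.
  apply: le_trans (measureU2 _ _ _) _ => //.
  rewrite (_ : 2 * s = (s - 0) + (1 - (1 - s))); last lra.
  by rewrite EFinD; apply: leeD; apply: uniform01_le; lra.
have fin : uniform_prob (@ltr01 R) (ends s) \is a fin_num
  by rewrite fin_num_measure//; exact: measurable_ends.
exists (fine (uniform_prob (@ltr01 R) (ends s))); first by rewrite fineK.
by rewrite -!lee_fin fineK// le2s andbT.
Qed.

End Corners.

(** * The complete graph: both tails of the diameter *)

Definition complete_set n : set (sgraph n) :=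
  [set G | forall i j, i != j -> adj G i j].

Lemma complete_iso n (G H : sgraph n) :
  sgraph_iso G H -> complete_set G -> complete_set H.
Proof.
move=> [s sGH] cG i j ij; rewrite -(permKV s i) -(permKV s j) sGH.
by apply: cG; rewrite (inj_eq perm_inj).
Qed.

Definition complete : graph_property := GraphProperty complete_iso.

Lemma increasing_complete : increasing complete.
Proof. by move=> n G G' GG' cG i j ij; apply/GG'/cG. Qed.

Section CompleteProb.
Variables (R : realType) (d n : nat).
Notation D := (Num.sqrt (d%:R : R)).
Notation F r := (points_law R d n [set x | complete n (geom_graph x r)]).
Notation point := (d.-tuple (measurableTypeR R)).
Notation ends := (@ends R : R -> set (measurableTypeR R)).

Lemma complete_geomE (x : n.-tuple point) (r : R) :
  complete n (geom_graph x r) <->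
  forall i j, i != j -> eucl_dist (tnth x i) (tnth x j) <= r.
Proof.
split=> cx i j ij; have := cx i j ij; first by rewrite /= /geom_adj ij.
by rewrite /= /geom_adj ij.
Qed.

Lemma measurable_complete (r : R) :
  measurable [set x : n.-tuple point | complete n (geom_graph x r)].
Proof. exact: measurable_geom_graph. Qed.

Lemma prob_complete_diam : F D = 1%:E.
Proof.
apply/eqP; rewrite eq_le; apply/andP; split.
  by apply: probability_le1; exact: measurable_complete.
rewrite -(prob_in_cube R d n); apply: le_prob.
- exact: measurable_in_cube.
- exact: measurable_complete.
by move=> x cx /=; apply/complete_geomE => i j _; apply: cube_dist_le;
  exact: cx.
Qed.

(** If no point is near a corner, no distance exceeds D - t by [far_ends]. *)
Lemma prob_complete_ge (t : R) : 0 <= t -> 4 * D * t <= 1 ->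
  (((1 - (4 * D * t) ^+ d) ^+ n)%:E <= F (D - t))%E.
Proof.
move=> t0 t1; set s := 2 * D * t.
have s0 : 0 <= s by rewrite /s !mulr_ge0// sqrtr_ge0.
have [u Uu /andP[u0 us]] := prob_ends s0.
have mE : measurable (ends s) by exact: measurable_ends.
pose H := tuple_pow n (~` tuple_pow d (ends s)) : set (n.-tuple point).
have mH : measurable H by apply: measurable_tuple_pow; apply: measurableC;
  exact: measurable_tuple_pow.
have PH : points_law R d n H = ((1 - u ^+ d) ^+ n)%:E.
  rewrite /points_law /H (@iid_prob_pow _ _ _ _ _ _ (1 - u ^+ d))//.
    by apply: measurableC; exact: measurable_tuple_pow.
  rewrite probability_setC; last exact: measurable_tuple_pow.
  by rewrite /uniform_cube (@iid_prob_pow _ _ _ _ _ _ u) ?EFinB.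
apply: (@le_trans _ _ ((1 - u ^+ d) ^+ n)%:E).
  have us' : u <= 4 * D * t by rewrite (le_trans us)// /s; lra.
  rewrite lee_fin lerXn2r ?nnegrE ?subr_ge0 ?exprn_ile1//.
  - by rewrite (le_trans u0).
  - exact: le_trans us' t1.
  - by rewrite lerD2l lerN2 lerXn2r// nnegrE (le_trans u0).
rewrite -PH; apply: (le_prob_ae (B := @in_cube R d n)) => //.
- exact: measurable_in_cube.
- exact: measurable_complete.
- exact: prob_in_cube.
move=> x [Hx cx]; apply/complete_geomE => i j ij; rewrite leNgt; apply/negP.
by move/(far_ends (cx i) (cx j)); exact: Hx.
Qed.

(** If the graph is complete of radius r, one of two opposite corner boxes
    contains no point. *)
Lemma prob_complete_le (s r : R) : (0 < d)%N -> 0 <= s -> s < 2^-1 ->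
  r < D * (1 - 2 * s) -> (F r <= (2 * (1 - s ^+ d) ^+ n)%:E)%E.
Proof.
move=> d0 s0 s1 rs.
pose B0 : set (measurableTypeR R) := `[0, s]%classic.
pose B1 : set (measurableTypeR R) := `[1 - s, 1]%classic.
pose H B := tuple_pow n (~` tuple_pow d B) : set (n.-tuple point).
have mB B : measurable B -> measurable (~` tuple_pow d B : set point).
  by move=> mB; apply: measurableC; exact: measurable_tuple_pow.
have mH B : measurable B -> measurable (H B).
  by move=> /mB; exact: measurable_tuple_pow.
have PH B : measurable B -> uniform_prob (@ltr01 R) B = s%:E ->
    points_law R d n (H B) = ((1 - s ^+ d) ^+ n)%:E.
  move=> mB' Bs; rewrite /points_law /H (@iid_prob_pow _ _ _ _ _ _ (1 - s ^+
    d))//.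
    exact: mB.
  rewrite probability_setC; last exact: measurable_tuple_pow.
  by rewrite /uniform_cube (@iid_prob_pow _ _ _ _ _ _ s) ?EFinB.
apply: (@le_trans _ _ (points_law R d n (H B0 `|` H B1))).
  apply: le_prob; first exact: measurable_complete.
    by apply: measurableU; apply: mH; exact: measurable_itv.
  move=> x /complete_geomE cx.
  have [H0|/existsNP[i /contrapT xi]] := pselect (H B0 x); first by left.
  have [H1|/existsNP[j /contrapT xj]] := pselect (H B1 x); first by right.
  have ij : i != j.
    apply: contraTneq isT => ij; move: xj; rewrite -ij => xj.
    have [_ h0] := itvccP (xi (Ordinal d0));
      have [h1 _] := itvccP (xj (Ordinal d0)).
    by exfalso; move: h0 h1; lra.
  have := cx i j ij; rewrite leNgt (lt_le_trans rs)//.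
  by apply: opposite_corners_dist => //; exact: ltW.
apply: le_trans (measureU2 _ _ _) _; [by apply: mH; exact: measurable_itv..|].
rewrite [X in (X + _)%E]PH//; last first.
  by rewrite uniform01_itv//; [congr EFin; lra|lra..].
  exact: measurable_itv.
rewrite [X in (_ + X)%E]PH//; last first.
  by rewrite uniform01_itv//; [congr EFin; lra|lra..].
  exact: measurable_itv.
by rewrite -EFinD lee_fin; lra.
Qed.

End CompleteProb.

(** * The complete graph: anticoncentration of the diameter *)

Section Shell.
Variables (R : realType) (d : nat).
Notation D := (Num.sqrt (d%:R : R)).
Notation point := (d.-tuple (measurableTypeR R)).
Notation ends := (@ends R : R -> set (measurableTypeR R)).
Notation cube := (tuple_pow d (`[0, 1]%classic : set (measurableTypeR R))).

Definition shell (r1 r2 : R) : set (point * point) :=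
  [set z | [/\ cube z.1, cube z.2 & r1 < eucl_dist z.1 z.2 <= r2]].

Lemma measurable_shell r1 r2 : measurable (shell r1 r2).
Proof.
have mc : measurable cube by exact: measurable_tuple_pow.
rewrite (_ : shell r1 r2 = (cube `*` cube) `&`
  ([set z : point * point | eucl_dist z.1 z.2 <= r2] `\`
   [set z : point * point | eucl_dist z.1 z.2 <= r1])).
  apply: measurableI; first exact: measurableX.
  by apply: measurableD; exact: measurable_eucl_dist_le.
apply/seteqP; split => z /=.
  by move=> [c1 c2 /andP[h1 h2]]; split => //; split => //; apply/negP;
    rewrite -ltNge.
by move=> [[c1 c2] [h2 /negP]]; rewrite -ltNge => h1; split => //; rewrite h1.
Qed.

End Shell.

Lemma eucl_dist_cons (R : realType) d (x0 : R) (x' : d.-tuple R) (y :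
  d.+1.-tuple R) :
  eucl_dist [tuple of x0 :: x'] y ^+ 2 = (x0 - tnth y ord0) ^+ 2 +
    \sum_(k < d) (tnth x' k - tnth y (lift ord0 k)) ^+ 2.
Proof.
rewrite sqr_eucl_dist big_ord_recl tnth0; congr (_ + _).
by apply: eq_bigr => k _; rewrite tnthS.
Qed.

Section ShellProb.
Variables (R : realType) (d' : nat).
Notation d := d'.+1.
Notation D := (Num.sqrt (d%:R : R)).
Notation point := (d.-tuple (measurableTypeR R)).
Variables (t r1 r2 : R).
Hypotheses (t0 : 0 <= t) (t1 : 4 * D * t <= 1) (r10 : 0 <= r1) (tr1 : D - t <=
  r1)
  (r12 : r1 <= r2).
Let l := r2 ^+ 2 - r1 ^+ 2.

Let l_ge0 : 0 <= l.
Proof. by rewrite subr_ge0 lerXn2r// nnegrE (le_trans r10). Qed.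

(** All coordinates but the first one of x being fixed, the difference w with
    the first coordinate of y has its square in an interval of length l, while
    its absolute value is at least 1/2. The map sending w to its square
    expands there, so that w takes either sign in a set of diameter at most
    l. *)
Lemma shell_first_coord (y : point) (x' : d'.-tuple (measurableTypeR R)) :
  (uniform_prob (@ltr01 R) [set x0 | shell r1 r2 (tuple_cons (x0, x'), y)]
    <= (4 * l)%:E)%E.
Proof.
set A := [set x0 | _].
have mA : measurable A.
  pose f (x0 : measurableTypeR R) : point * point := (tuple_cons (x0, x'), y).
  have mf : measurable_fun setT f.
    apply: measurable_fun_pair => //; apply: measurableT_comp.
      exact: measurable_tuple_cons.
    exact: measurable_fun_pair.
  by rewrite -[A]setTI; apply: mf => //; exact: measurable_shell.
pose y0 := tnth y ord0.
have key x0 z0 : A x0 -> A z0 -> 2^-1 <= `|x0 - y0| -> 2^-1 <= `|z0 - y0| ->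
    `|x0 - y0| - `|z0 - y0| <= l.
  move=> [_ _ /andP[/= _ xr]] [_ _ /andP[/= zr _]] hx hz.
  move: xr zr.
  rewrite -(@ler_sqr _ _ r2) ?nnegrE ?eucl_dist_ge0//; last exact: le_trans r12.
  rewrite -(@ltr_sqr _ r1) ?nnegrE ?eucl_dist_ge0// !eucl_dist_cons -/y0.
  rewrite -[(x0 - y0) ^+ 2]real_normK ?num_real// -[(z0 - y0) ^+ 2]real_normK
    ?num_real//.
  set w := `|x0 - y0| in hx *; set v := `|z0 - y0| in hz *.
  move: l_ge0; rewrite /l => l0 h1 h2.
  have [wv|vw] := leP w v; first by lra.
  (* w - v <= (w - v) (w + v) <= l *)
  suff : 0 <= (w - v) * (w + v - 1) by nra.
  by rewrite mulr_ge0; lra.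
have far x0 : A x0 -> 2^-1 <= `|x0 - y0|.
  move=> [/= cx cy /andP[h1 _]].
  have := far_coord ord0 cx cy (le_lt_trans tr1 h1); rewrite tnth0 -/y0.
  move: t1; lra.
have mle : measurable (A `&` `]-oo, y0]%classic) by apply: measurableI.
have mge : measurable (A `&` `[y0, +oo[%classic) by apply: measurableI.
apply: (@le_trans _ _ (uniform_prob (@ltr01 R)
  ((A `&` `]-oo, y0]%classic) `|` (A `&` `[y0, +oo[%classic)))).
  apply: le_prob => //; first exact: measurableU.
  move=> x0 Ax0 /=; rewrite !in_itv/= andbT.
  by have [h|h] := leP x0 y0; [left|right; split => //; exact: ltW].
apply: le_trans (measureU2 _ _ _) _ => //.
rewrite (_ : 4 * l = 2 * l + 2 * l); last lra.
rewrite EFinD; apply: leeD; apply: uniform01_diam => // a b [Aa]/= + [Ab]/=.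
  rewrite !in_itv/= => ha hb; have := key b a Ab Aa (far _ Ab) (far _ Aa).
  by rewrite !ler0_norm ?subr_le0//; lra.
rewrite !in_itv/= !andbT => ha hb; have := key a b Aa Ab (far _ Aa) (far _ Ab).
by rewrite !ger0_norm ?subr_ge0//; lra.
Qed.

Lemma shell_section (y : point) :
  (uniform_cube R d [set x | shell r1 r2 (x, y)] <= (4 * l * (4 * D * t) ^+
    d')%:E)%E.
Proof.
have s0 : 0 <= 2 * D * t by rewrite !mulr_ge0// sqrtr_ge0.
have [u Uu /andP[u0 us]] := prob_ends s0.
have mS : measurable [set x : point | shell r1 r2 (x, y)].
  have mf : measurable_fun setT (fun x : point => (x, y))
    by exact: measurable_fun_pair.
  rewrite -[X in measurable X]setTI; apply: mf => //; exact: measurable_shell.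
rewrite /uniform_cube iid_prob_consE//.
pose E := tuple_pow d' (ends (2 * D * t)) : set (d'.-tuple (measurableTypeR R)).
have mE : measurable E by apply: measurable_tuple_pow; exact: measurable_ends.
apply: (@le_trans _ _ ((4 * l)%:E * iid_prob (uniform_prob (@ltr01 R)) d' E)%E).
  apply: product_prob_le => //.
  - by rewrite mulr_ge0.
  - rewrite -[X in measurable X]setTI; apply: measurable_tuple_cons => //.
  - move=> x0 x' [/= cx cy /andP[h _]] k.
    have := far_ends cx cy (le_lt_trans tr1 h) (lift ord0 k); by rewrite tnthS.
  - by move=> x' _; exact: shell_first_coord.
rewrite /E (@iid_prob_pow _ _ _ _ _ _ u)//; last exact: measurable_ends.
rewrite -EFinM lee_fin ler_wpM2l ?mulr_ge0// lerXn2r ?nnegrE//.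
  by rewrite !mulr_ge0// sqrtr_ge0.
by rewrite (le_trans us)//; lra.
Qed.

Lemma shell_prob :
  ((uniform_cube R d \x uniform_cube R d)%E (shell r1 r2) <=
    (4 * l * (4 * D * t) ^+ d' * (4 * D * t) ^+ d)%:E)%E.
Proof.
have D0 : 0 <= D by exact: sqrtr_ge0.
have s0 : 0 <= 2 * D * t by rewrite !mulr_ge0.
have [u Uu /andP[u0 us]] := prob_ends s0.
pose E := tuple_pow d (ends (2 * D * t)) : set point.
have mE : measurable E by apply: measurable_tuple_pow; exact: measurable_ends.
have b0 : 0 <= 4 * l * (4 * D * t) ^+ d'
  by rewrite !mulr_ge0// exprn_ge0// !mulr_ge0.
apply: (@le_trans _ _ ((4 * l * (4 * D * t) ^+ d')%:E * uniform_cube R d E)%E).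
  apply: product_prob_le => //.
  - exact: measurable_shell.
  - move=> x y [/= cx cy /andP[h _]].
    by apply: (far_ends cy cx); rewrite eucl_distC; exact: le_lt_trans tr1 h.
  - by move=> y _; exact: shell_section.
rewrite /E /uniform_cube (@iid_prob_pow _ _ _ _ _ _ u)//;
  last exact: measurable_ends.
rewrite -EFinM lee_fin ler_wpM2l// lerXn2r ?nnegrE//;
  first by rewrite !mulr_ge0.
by rewrite (le_trans us)//; lra.
Qed.

Notation F n r := (points_law R d n [set x | complete n (geom_graph x r)]).

(** When the graph becomes complete between the radii r1 and r2, some pair of
    points has its distance in between. *)
Lemma prob_complete_increment n :
  (F n r2 <= F n r1 +
    ((n * n)%:R * (4 * l * (4 * D * t) ^+ d' * (4 * D * t) ^+ d))%:E)%E.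
Proof.
set b := 4 * l * _ * _.
have b0 : 0 <= b by rewrite !mulr_ge0 ?exprn_ge0 ?mulr_ge0 ?sqrtr_ge0.
pose E (p : 'I_n * 'I_n) : set (n.-tuple point) :=
  if p.1 == p.2 then set0 else [set x | shell r1 r2 (tnth x p.1, tnth x p.2)].
have mE p : measurable (E p).
  rewrite /E; case: ifP => // _; rewrite -[X in measurable X]setTI.
  exact: (@measurable_coord_pair _ _ n p.1 p.2) (measurable_shell r1 r2).
have mU : measurable [set x | exists p, E p x] by exact: measurable_exists_fin.
have PE p : (points_law R d n (E p) <= b%:E)%E.
  rewrite /E; case: ifPn => [_|pp]; first by rewrite measure0 lee_fin.
  rewrite /points_law iid_prob_pair//;
    [exact: shell_prob|exact: measurable_shell].
have := prob_exists_fin mU mE (fun x h => h) PE.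
rewrite card_prod card_ord => PU.
apply: (@le_trans _ _ (points_law R d n
  ([set x | complete n (geom_graph x r1)] `|` [set x | exists p, E p x]))).
  apply: (le_prob_ae (B := @in_cube R d n)).
  - exact: measurable_complete.
  - exact: measurable_in_cube.
  - by apply: measurableU => //; exact: measurable_complete.
  - exact: prob_in_cube.
  move=> x [/complete_geomE cx2 cx].
  have [|nc] := pselect (complete n (geom_graph x r1)); first by left.
  right; apply: contrapT => nE; apply: nc; apply/complete_geomE => i j ij.
  rewrite leNgt; apply/negP => h; apply: nE; exists (i, j).
  rewrite /E/= (negbTE ij); split => /=; [exact: cx|exact: cx|].
  by rewrite h/= cx2.
apply: le_trans (measureU2 _ _ _) _ => //; first exact: measurable_complete.
exact: leeD.
Qed.

End ShellProb.

(** * Width of the complete graph property *)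

Section Reals.
Variable R : realType.

(** A lower bound on how fast (1 - a)^n decays, of order 1 / (n a): enough here
    and free of logarithms. *)
Lemma onem_expn_le (a : R) n : 0 <= a <= 1 -> (1 - a) ^+ n * (1 + n%:R * a) <=
  1.
Proof.
move=> /andP[a0 a1]; elim: n => [|n IHn]; first by rewrite mul0r addr0 mulr1.
apply: le_trans IHn; rewrite exprSr -mulrA ler_wpM2l ?exprn_ge0 ?subr_ge0//.
have : 0 <= (n%:R : R) by []; rewrite -natr1; nra.
Qed.

Lemma expR_onem_le (v : R) : 0 <= v <= 2^-1 -> expR (- (2 * v)) <= 1 - v.
Proof.
move=> /andP[v0 v1]; rewrite expRN -[leRHS]invrK lef_pV2 ?posrE ?invr_gt0
  ?expR_gt0//; last lra.
apply: le_trans (expR_ge1Dx _); rewrite -[leLHS]mul1r ler_pdivrMr; last lra.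
nra.
Qed.

Lemma expR_onem_expn_le (v : R) n : 0 <= v <= 2^-1 ->
  expR (- (2 * v * n%:R)) <= (1 - v) ^+ n.
Proof.
move=> v01; rewrite -mulNr expRM_natr lerXn2r ?nnegrE ?expR_ge0 ?expR_onem_le//.
by case/andP: v01 => *; lra.
Qed.

(** The distance n^(-1/d) at which a typical point has its nearest neighbour. *)
Definition scale d n : R := n%:R `^ (- d%:R^-1).

Lemma scale_ge0 d n : 0 <= scale d n.
Proof. exact: powR_ge0. Qed.

Lemma scale_gt0 d n : (0 < n)%N -> 0 < scale d n.
Proof. by move=> n0; rewrite powR_gt0 ?ltr0n. Qed.

Lemma scale_expn d n : (0 < d)%N -> (0 < n)%N -> scale d n ^+ d * n%:R = 1.
Proof.
move=> d0 n0; rewrite -powR_mulrn ?powR_ge0// /scale -powRrM mulNr mulVf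
  ?pnatr_eq0 -?lt0n//.
by rewrite powR_inv1 ?ler0n// mulVf// pnatr_eq0 -lt0n.
Qed.

Lemma near_scale_lt d (e : R) : (0 < d)%N -> 0 < e ->
  \forall n \near \oo, scale d n < e.
Proof.
move=> d0 e0; near=> n.
have n0 : (0 < n)%N by near: n; exact: nbhs_infty_gt.
have ne : (e ^+ d)^-1 < n%:R by near: n; exact: nbhs_infty_gtr.
rewrite -(ltr_pXn2r d0) ?nnegrE ?scale_ge0 ?(ltW e0)//.
have := scale_expn d0 n0; set w := scale d n ^+ d => wn.
rewrite -(@ltr_pM2r _ n%:R) ?ltr0n// wn.
by rewrite -(@ltr_pM2l _ (e ^+ d)^-1) ?invr_gt0 ?exprn_gt0// mulr1 mulrA mulVf
  ?mul1r// gt_eqF// exprn_gt0.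
Unshelve. all: by end_near. Qed.

End Reals.

Section CompleteWidth.
Variables (R : realType) (d' : nat).
Notation d := d'.+1.
Notation D := (Num.sqrt (d%:R : R)).
Notation F n r := (points_law R d n [set x | complete n (geom_graph x r)]).
Notation nu := (@scale R d).

Lemma sqrt_dim_ge1 : 1 <= D.
Proof. by rewrite -[leLHS]sqrtr1 ler_wsqrtr// ler1n. Qed.

Lemma sqrt_dim_gt0 : 0 < D.
Proof. exact: lt_le_trans sqrt_dim_ge1. Qed.

(** The corner boxes have side M nu with M = 2 / e, so that each holds on
  average
    M^d >= M points and is empty with probability at most 1 / (1 + M). *)
Lemma complete_upper_tail (e : R) : 0 < e <= 1 ->
  \forall n \near \oo, (F n (D - 8 * D / e * nu n) < e%:E)%E.
Proof.
have D1 := sqrt_dim_ge1; have D0 := sqrt_dim_gt0.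
move=> /andP[e0 e1]; pose M : R := 2 / e.
have M1 : 1 <= M by rewrite /M ler_pdivlMr//; lra.
near=> n.
have n0 : (0 < n)%N by near: n; exact: nbhs_infty_gt.
have nu0 : 0 < nu n by exact: scale_gt0.
have Mnu : M * nu n < 2^-1.
  rewrite mulrC -ltr_pdivlMr; last by lra.
  by near: n; apply: near_scale_lt => //; rewrite divr_gt0//; lra.
have s0 : 0 <= M * nu n by rewrite mulr_ge0 ?(ltW nu0)//; lra.
have rs : D - 8 * D / e * nu n < D * (1 - 2 * (M * nu n)).
  have M0 : 0 < M by lra.
  have : 0 < D * (M * nu n) by rewrite mulr_gt0//; exact: mulr_gt0.
  have -> : 8 * D / e = 4 * (D * M) by rewrite /M; lra.
  by lra.
apply: le_lt_trans (prob_complete_le n _ s0 Mnu rs) _ => //.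
set a := (M * nu n) ^+ d; rewrite lte_fin.
have a01 : 0 <= a <= 1 by rewrite exprn_ge0//= exprn_ile1//; lra.
have na : n%:R * a = M ^+ d.
  by rewrite /a exprMn mulrCA [_ * nu n ^+ d]mulrC scale_expn// mulr1.
have := onem_expn_le n a01; rewrite na => h.
have MM : M <= M ^+ d by rewrite ler_eXnr.
have p0 : 0 <= (1 - a) ^+ n by rewrite exprn_ge0//; lra.
have : (1 - a) ^+ n * (1 + M) <= 1 by apply: le_trans h; rewrite ler_wpM2l//;
  lra.
have Me : M * e = 2 by rewrite /M mulfVK// gt_eqF.
set p := (1 - a) ^+ n in p0 *; nra.
Unshelve. all: by end_near. Qed.

(** With rho the threshold at e, the probability is below e just before rho,
    and by [prob_complete_increment] it cannot have grown by 1 - 2 e just after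
    it. Below, C bounds the growth per unit of c over a window of length
    c nu. *)
Lemma complete_width_ge (e : R) : 0 < e < 2^-1 ->
  exists2 c : R, 0 < c & \forall n \near \oo, c * nu n <= width d complete n e.
Proof.
have D1 := sqrt_dim_ge1; have D0 := sqrt_dim_gt0.
move=> /andP[e0 e1].
have [K KE K1] : exists2 K : R, K = 8 * D / e + 1 & 1 <= K.
  by eexists; [reflexivity|rewrite lerDr divr_ge0 ?mulr_ge0//; lra].
pose C : R := 16 * D * (4 * D * K) ^+ d' * (4 * D * K) ^+ d.
have K0 : 0 <= 4 * D * K by rewrite !mulr_ge0//; lra.
have C0 : 0 <= C by rewrite /C !mulr_ge0 ?exprn_ge0//; lra.
pose c : R := (1 - 2 * e) / (C + 2).
have c0 : 0 < c by rewrite divr_gt0//; lra.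
have c1 : c <= 1 by rewrite ler_pdivrMr//; lra.
have Cc : C * c < 1 - 2 * e.
  have : (C + 2) * c = 1 - 2 * e by rewrite mulrC mulfVK//; lra.
  by lra.
exists (c / 2); first lra.
near=> n.
have n0 : (0 < n)%N by near: n; exact: nbhs_infty_gt.
have nu0 : 0 < nu n by exact: scale_gt0.
have tail : (F n (D - 8 * D / e * nu n) < e%:E)%E.
  by near: n; apply: complete_upper_tail; apply/andP; split; lra.
have small : 4 * D * (K * nu n) < 1.
  rewrite mulrA mulrC -ltr_pdivlMr; last by rewrite !mulr_gt0//; clear -K1; lra.
  by near: n; apply: near_scale_lt => //; rewrite divr_gt0// !mulr_gt0//; lra.
set rho := threshold d complete n e.
have FD := prob_complete_diam R d n.
have rho_ge : D - 8 * D / e * nu n <= rho.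
  by apply: (le_threshold increasing_complete D0) tail; rewrite FD lee_fin;
    clear -e0 e1; lra.
have rho_le : rho <= D by apply: threshold_le => //; rewrite FD lee_fin;
  clear -e0 e1; lra.
have Knu : 8 * D / e * nu n + nu n = K * nu n by rewrite KE; clear; lra.
have cnu : c * nu n <= nu n by rewrite ler_piMl// ltW.
have cnu0 : 0 < c * nu n by rewrite mulr_gt0.
have Knu0 : 0 <= K * nu n
  by rewrite mulr_ge0 ?(ltW nu0) ?(le_trans ler01 K1).
have KnuD : 4 * (K * nu n) < 1.
  apply: le_lt_trans small; rewrite [leRHS]mulrAC ler_peMr//.
  by clear -Knu0; lra.
(* a window around the threshold, of length c nu *)
pose r1 : R := rho - c * nu n / 2.
pose r2 : R := rho + c * nu n / 2.
have r10 : 0 < r1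
  by rewrite /r1; clear -D1 rho_ge Knu KnuD cnu nu0; lra.
have Fr1 : (F n r1 < e%:E)%E.
  rewrite ltNge; apply/negP => /(threshold_le r10); rewrite -/rho /r1.
  by clear -cnu0; lra.
have Fr2 : (F n r2 < (1 - e)%:E)%E.
  apply: le_lt_trans (prob_complete_increment (t := K * nu n) (r1 := r1) _ _ _
    _ _ _) _ => //.
  - exact: ltW.
  - exact: ltW.
  - by rewrite /r1; clear -rho_ge Knu cnu cnu0; lra.
  - by rewrite /r1 /r2; clear -cnu0; lra.
  set X := _ * _.
  have Xle : X <= C * c.
    rewrite /X /C.
    have -> : r2 ^+ 2 - r1 ^+ 2 = 2 * (c * nu n) * rho by rewrite /r1 /r2;
      clear; lra.
    rewrite (mulrA (4 * D)) natrM; set B := 4 * D * K.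
    rewrite [(B * _) ^+ d']exprMn [(B * _) ^+ d]exprMn; set P := B ^+ d';
      set Q := B ^+ d.
    have wn := scale_expn R (ltn0Sn d') n0.
    have -> : n%:R * n%:R * (4 * (2 * (c * nu n) * rho) * (P * nu n ^+ d') *
        (Q * nu n ^+ d)) =
        8 * rho * P * Q * c * (nu n ^+ d' * nu n * n%:R) * (nu n ^+ d * n%:R)
      by clear; lra.
    rewrite -exprSr wn !mulr1 ler_wpM2r ?(ltW c0)//.
    by rewrite !ler_wpM2r ?exprn_ge0//; clear -rho_le D0; lra.
  apply: (@le_lt_trans _ _ (F n r1 + (C * c)%:E)%E);
    first by rewrite leeD2l// lee_fin.
  apply: (@lt_le_trans _ _ (e%:E + (C * c)%:E)%E); first by rewrite lte_leD.
  by rewrite -EFinD lee_fin; clear -Cc; lra.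
have : r2 <= threshold d complete n (1 - e).
  by apply: (le_threshold increasing_complete D0) Fr2; rewrite FD lee_fin;
    clear -e0 e1; lra.
by rewrite /width -/rho /r2; clear; lra.
Unshelve. all: by end_near. Qed.

(** With L = ln (1/e), the corner neighbourhoods of [prob_complete_ge] have
    volume at most L / (2^d n), and are empty with probability at least
    exp (- L). *)
Lemma complete_threshold_le (e : R) : 0 < e < 1 ->
  \forall n \near \oo,
    threshold d complete n e <= D - ln e^-1 `^ d%:R^-1 / (8 * D) * nu n.
Proof.
have D1 := sqrt_dim_ge1; have D0 := sqrt_dim_gt0.
move=> /andP[e0 e1]; set L := ln e^-1.
have L0 : 0 <= L by rewrite ln_ge0// invf_ge1// ltW.
have eL : expR (- L) = e by rewrite /L lnV ?posrE// opprK lnK ?posrE.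
set X := L `^ _.
have X0 : 0 <= X by exact: powR_ge0.
have XL : X ^+ d = L
  by rewrite /X -powR_mulrn ?powR_ge0// -powRrM mulVf// powRr1.
near=> n.
have n0 : (0 < n)%N by near: n; exact: nbhs_infty_gt.
have nu0 : 0 < nu n by exact: scale_gt0.
have Ln : L < n%:R by near: n; exact: nbhs_infty_gtr.
have Xnu : X * nu n <= 1.
  have : nu n < (X + 1)^-1 by near: n; apply: near_scale_lt => //;
    rewrite invr_gt0; lra.
  rewrite -[_^-1]mul1r ltr_pdivlMr; last lra.
  by nra.
set t := X / (8 * D) * nu n.
have tE : 4 * D * t = X * nu n / 2.
  have DV : D * D^-1 = 1 by rewrite divff// gt_eqF.
  rewrite /t invfM.
  have -> : 4 * D * (X * (8^-1 * D^-1) * nu n) = (D * D^-1) * (X * nu n / 2) by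
    lra.
  by rewrite DV mul1r.
have Xnu0 : 0 <= X * nu n by rewrite mulr_ge0// ltW.
have t0 : 0 <= t by rewrite /t mulr_ge0 ?(ltW nu0)// divr_ge0// mulr_ge0// ltW.
have t1 : 4 * D * t <= 1 by rewrite tE; lra.
apply: threshold_le; first by nra.
apply: le_trans (prob_complete_ge n t0 t1).
rewrite lee_fin tE.
set v := (X * nu n / 2) ^+ d.
have v0 : 0 <= v by rewrite exprn_ge0//; lra.
have vn : 2 * v * n%:R <= L.
  rewrite /v exprMn exprMn XL.
  have -> : 2 * (L * nu n ^+ d * 2^-1 ^+ d) * n%:R =
    2 * L * 2^-1 ^+ d * (nu n ^+ d * n%:R) by lra.
  rewrite scale_expn// mulr1.
  have : 2^-1 ^+ d <= 2^-1 :> R by rewrite ler_iXnr//; lra.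
  nra.
have v1 : v <= 2^-1.
  have : X * nu n / 2 <= 2^-1 by lra.
  by apply: le_trans; rewrite ler_iXnr//; lra.
rewrite -eL; apply: le_trans (expR_onem_expn_le n _); last by rewrite v0.
by rewrite ler_expR lerN2.
Unshelve. all: by end_near. Qed.

End CompleteWidth.

(** If (ln 1/e)^(1/d) is at least a constant K / c2, the two thresholds are
    separated by the tail estimates; otherwise it is bounded, and the width at
    e is at least the one at e0. *)
Lemma width_complete (R : realType) d : (0 < d)%N ->
  width_Omega d complete (fun (n : nat) (eps : R) =>
    ln eps^-1 `^ d%:R^-1 * n%:R `^ (- d%:R^-1)).
Proof.
case: d => // d' _ e0 /andP[e00 e01].
set D : R := Num.sqrt d'.+1%:R.
have D0 : 0 < D := sqrt_dim_gt0 R d'.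
have [c1 c10 wide] := @complete_width_ge R d' e0 (introT andP (conj e00 e01)).
set K := 8 * D / e0.
have K0 : 0 < K by rewrite divr_gt0// mulr_gt0.
pose c2 : R := (16 * D)^-1.
have c20 : 0 < c2 by rewrite invr_gt0 mulr_gt0.
pose c : R := Num.min c2 (c1 * c2 / K).
have c0 : 0 < c by rewrite lt_min c20 divr_gt0// mulr_gt0.
exists c => // e /andP[ep ee].
set X := ln e^-1 `^ _.
have X0 : 0 <= X by exact: powR_ge0.
near=> n.
have n0 : (0 < n)%N by near: n; exact: nbhs_infty_gt.
have nu0 : 0 < scale R d'.+1 n by exact: scale_gt0.
have FD := prob_complete_diam R d'.+1 n.
rewrite -/(scale R d'.+1 n).
have [XK|XK] := leP K (c2 * X).
  have h1 : threshold d'.+1 complete n e <= D - X / (8 * D) * scale R d'.+1 n.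
    near: n; apply: complete_threshold_le; lra.
  have h2 : D - K * scale R d'.+1 n <= threshold d'.+1 complete n (1 - e).
    have tail : (points_law R d'.+1 n [set x | complete n
        (geom_graph x (D - K * scale R d'.+1 n))] < e0%:E)%E.
      near: n; apply: complete_upper_tail; lra.
    apply: (le_threshold increasing_complete D0); first by rewrite FD lee_fin;
      clear -ep; lra.
    by apply: lt_le_trans tail _; rewrite lee_fin; clear -ee e01; lra.
  have XD : X / (8 * D) = 2 * c2 * X by rewrite /c2 !invfM; lra.
  have cc2 : c <= c2 by rewrite ge_min lexx.
  have a1 : 0 <= (c2 * X - K) * scale R d'.+1 n.
    by rewrite mulr_ge0 ?subr_ge0// ltW.
  have a2 : 0 <= (c2 - c) * (X * scale R d'.+1 n).
    by rewrite mulr_ge0 ?subr_ge0// mulr_ge0// ltW.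
  by rewrite /width; move: h1; rewrite XD; clear -a1 a2 h2; lra.
have h3 : c1 * scale R d'.+1 n <= width d'.+1 complete n e0 by near: n;
  exact: wide.
have h4 : width d'.+1 complete n e0 <= width d'.+1 complete n e.
  by rewrite /width; apply: lerB; apply: (threshold_mono D0);
    rewrite ?FD ?lee_fin;
    clear -ep ee e00 e01; lra.
apply: le_trans h4; apply: le_trans h3; rewrite mulrA ler_wpM2r ?(ltW nu0)//.
have : c <= c1 * c2 / K by rewrite ge_min lexx orbT.
rewrite ler_pdivlMr// => cK.
nra.
Unshelve. all: by end_near. Qed.

(** * Weights and counts of subsets *)

Lemma prob_disjoint_fin d (T : measurableType d) (R : realType)
    (P : probability T R) (I : finType) (S : pred I) (C : I -> set T) :
  (forall i, measurable (C i)) ->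
  (forall i j x, C i x -> C j x -> i = j) ->
  P [set x | exists2 i, S i & C i x] = (\sum_(i | S i) P (C i))%E.
Proof.
move=> mC CI; pose r := [seq i <- index_enum I | S i].
have rS i : i \in r = S i by rewrite mem_filter mem_index_enum andbT.
rewrite (_ : [set x | _] = \bigcup_(i in [set` r]) C i); last first.
  apply/seteqP; split => x /= [i Si Cix]; exists i => //=; first by rewrite rS.
  by move: Si; rewrite /= rS.
rewrite measure_fin_bigcup//.
- by rewrite -fsbig_seq ?filter_uniq ?index_enum_uniq// big_filter.
- by move=> i j _ _ [x [Cix Cjx]]; exact: CI Cix Cjx.
Qed.

Section SubsetWeights.
Variable R : realType.

(** The probability of S for the random subset of 'I_n that contains each
    element independently with probability p. *)
Definition subset_prob n (p : R) (S : {set 'I_n} -> bool) : R :=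
  \sum_(b : {set 'I_n} | S b) p ^+ #|b| * (1 - p) ^+ (n - #|b|).

Lemma prob_pattern d (T : measurableType d) (P : probability T R) n
    (B : set T) (p : R) (S : {set 'I_n} -> bool) :
  measurable B -> P B = p%:E ->
  iid_prob P n [set x | S [set i | tnth x i \in B]%SET] = (subset_prob p S)%:E.
Proof.
move=> mB PB.
pose side (b : bool) := if b then B else ~` B.
have mside b : measurable (side b) by case: b => //; exact: measurableC.
pose C (b : {set 'I_n}) := [set x : n.-tuple T | forall i, side (i \in b) (tnth
  x i)].
have mC b : measurable (C b)
  by apply: (@measurable_box _ _ n (fun i => side (i \in b))).
have CE b x : C b x <-> b = [set i | tnth x i \in B]%SET.
  rewrite /C /=; split=> [Cx|->{b} i].
    apply/setP => i; rewrite inE; have := Cx i; rewrite /side.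
    by case: (i \in b) => h; [rewrite mem_set|rewrite memNset].
  rewrite /side inE; case: ifPn => [/set_mem//|]; by rewrite notin_setE.
rewrite (_ : [set x | _] = [set x | exists2 b, S b & C b x]); last first.
  apply/seteqP; split => x /=.
    by move=> Sx; exists [set i | tnth x i \in B]%SET => //; apply/CE.
  by move=> [b Sb /CE bE]; rewrite -bE.
rewrite prob_disjoint_fin//; last by move=> b b' x /CE-> /CE->.
rewrite /subset_prob -sumEFin; apply: eq_bigr => b _.
rewrite /C (@iid_prob_box _ _ _ P n (fun i => side (i \in b)))//.
rewrite (eq_bigr (fun i => (if i \in b then p else 1 - p)%:E)); last first.
  move=> i _; rewrite /side; case: ifP => _//.
  by rewrite probability_setC// PB.
rewrite prodEFin; congr EFin.
rewrite (bigID (mem b))/= (eq_bigr (fun=> p)); last by move=> i ->.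
rewrite prodr_const; congr (_ * _).
rewrite (eq_bigr (fun=> 1 - p)); last by move=> i /negbTE->.
rewrite prodr_const; congr (_ ^+ _).
rewrite -[X in (X - _)%N](card_ord n) -(cardC (mem b)) addKn.
by apply: eq_card => i; rewrite !inE.
Qed.

Lemma subset_probC n (p : R) (S : {set 'I_n} -> bool) :
  subset_prob p (fun b => S (~: b)%SET) = subset_prob (1 - p) S.
Proof.
rewrite /subset_prob (reindex_inj (inv_inj (@finset.setCK _)))/=.
apply: eq_big => [b|b _]; first by rewrite finset.setCK.
have bn : (#|b| <= n)%N by rewrite -[n in (_ <= n)%N]card_ord max_card.
rewrite cardsCs finset.setCK card_ord subKn// mulrC.
by have -> : 1 - (1 - p) = p by lra.
Qed.

(** Successes minus failures. *)
Definition imbalance n (b : {set 'I_n}) : R := 2 * #|b|%:R - n%:R.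

Lemma imbalanceE n (b : {set 'I_n}) :
  imbalance b = \sum_(i < n) (-1) ^+ (i \notin b).
Proof.
rewrite (bigID (mem b))/= (eq_bigr (fun=> 1)); last by move=> i ->.
rewrite [X in _ + X](eq_bigr (fun=> -1)); last by move=> i ->.
rewrite !sumr_const /imbalance -[in n%:R](card_ord n) -(cardC (mem b)) natrD.
rewrite mulNrn.
have -> : #|[pred i | i \notin b]| = #|[predC mem b]| by [].
lra.
Qed.

Lemma card_subsets n : #|{set 'I_n}| = (2 ^ n)%N.
Proof. by rewrite -cardsT -powersetT card_powerset cardsT card_ord. Qed.

Definition flip n (i : 'I_n) (b : {set 'I_n}) : {set 'I_n} :=
  [set k | (k \in b) (+) (k == i)]%SET.

Lemma flipK n (i : 'I_n) : involutive (flip i).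
Proof. by move=> b; apply/setP => k; rewrite !inE addbK. Qed.

(** The signs of distinct elements are orthogonal, since toggling i reverses
    one of them only. *)
Lemma sum_signs n (i j : 'I_n) :
  \sum_(b : {set 'I_n}) (-1) ^+ (i \notin b) * (-1) ^+ (j \notin b) =
  (if i == j then 2 ^+ n else 0) :> R.
Proof.
case: eqVneq => [->|ij].
  rewrite (eq_bigr (fun=> 1)); last by move=> b _; rewrite -expr2 sqrr_sign.
  by rewrite sumr_const card_subsets natrX.
set s := LHS; suff : s = - s by lra.
rewrite {1}/s (reindex_inj (inv_inj (@flipK _ i))) -sumrN;
  apply: eq_bigr => b _.
rewrite !inE eqxx addbT eq_sym (negbTE ij) addbF negbK -mulNr; congr (_ * _).
by case: (i \in b); rewrite ?expr0 ?expr1 ?opprK.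
Qed.

(** The variance of n fair signs. *)
Lemma sum_sqr_imbalance n :
  \sum_(b : {set 'I_n}) imbalance b ^+ 2 = n%:R * 2 ^+ n.
Proof.
under eq_bigr do rewrite imbalanceE expr2 mulr_suml.
rewrite exchange_big/=.
under eq_bigr => i _ do under eq_bigr => b _ do rewrite mulr_sumr.
under eq_bigr => i _ do rewrite exchange_big/=.
under eq_bigr => i _ do under eq_bigr => j _ do rewrite sum_signs.
rewrite (eq_bigr (fun=> 2 ^+ n)); last first.
  move=> i _; rewrite (bigD1 i)//= eqxx big1 ?addr0// => j ji.
  by rewrite eq_sym (negbTE ji).
by rewrite sumr_const card_ord mulr_natl.
Qed.

(** Chebyshev's inequality. *)
Lemma card_far n (J : R) : 0 <= J ->
  J ^+ 2 * #|[set b : {set 'I_n} | J < `|imbalance b|]%SET|%:R <= n%:R * 2 ^+ n.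
Proof.
move=> J0; rewrite -sum_sqr_imbalance mulr_natr -sumr_const.
rewrite [leRHS](bigID (mem [set b : {set 'I_n} | J < `|imbalance b|]%SET))/=.
rewrite ler_wpDr ?sumr_ge0// => [b _|]; first exact: sqr_ge0.
apply: ler_sum => b; rewrite inE => Jb.
by rewrite -[leRHS]real_normK ?num_real// lerXn2r ?nnegrE// ltW.
Qed.

(** The quotient of consecutive central binomial coefficients is
    2 (2 m + 1) / (m + 1), and (2 m + 1) (2 m + 3) <= 4 (m + 1)^2. *)
Lemma bin_central m : ('C(m.*2, m) ^ 2 * m.*2.+1 <= 16 ^ m)%N.
Proof.
elim: m => [//|m IHm].
have key : (m.+1 * 'C(m.+1.*2, m.+1) = 2 * m.*2.+1 * 'C(m.*2, m))%N.
  have := mul_bin_diag m.+1.*2 m; rewrite doubleS /= => <-.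
  have := mul_bin_down m.*2.+1 m; rewrite /= -addnn -addSn addnK => h.
  lia.
rewrite -(leq_pmul2l (m := m.+1 ^ 2))// mulnA -expnMn key [(16 ^ _)%N]expnS.
have : ((2 * m.*2.+1 * 'C(m.*2, m)) ^ 2 * m.+1.*2.+1 =
  4 * m.*2.+1 * m.*2.+3 * ('C(m.*2, m) ^ 2 * m.*2.+1))%N.
  by rewrite doubleS; lia.
move=> ->; apply: leq_trans (leq_mul (leqnn _) IHm) _.
rewrite mulnA leq_mul2r; apply/orP; right; nia.
Qed.

(** An exact tie among n fair trials has probability at most 1 / sqrt n. *)
Lemma card_balanced n :
  (#|[set b : {set 'I_n} | (2 * #|b| == n)%N]%SET| ^ 2 * n <= 4 ^ n)%N.
Proof.
have [no|ne] := boolP (odd n).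
  rewrite (_ : [set b | _]%SET = finset.set0) ?cards0//.
  apply/setP => b; rewrite !inE; apply/negbTE; apply: contraTneq no => <-.
  by rewrite mul2n odd_double.
rewrite -[n]odd_double_half (negbTE ne) add0n; set m := n./2.
rewrite (_ : [set b | _]%SET = [set b : {set 'I_(m.*2)} | #|b| == m]%SET);
  last first.
  by apply/setP => b; rewrite !inE mul2n (inj_eq double_inj).
rewrite card_draws card_ord (leq_trans (leq_trans _ (bin_central m)))//.
  by rewrite leq_mul2l leqnSn orbT.
by rewrite -mul2n expnM.
Qed.

End SubsetWeights.

(** * Lower bound on a binomial majority *)

Section MajorityTail.
Variable R : realType.

(** Complementation exchanges the two signs of the imbalance, so that a fair
    sample has positive imbalance at most J with probability nearly 1/2: one
    only loses ties and large deviations. *)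
Lemma card_window n (J : R) : (0 < n)%N -> 0 < J ->
  2 ^+ n * ((1 - (Num.sqrt n%:R)^-1 - n%:R / J ^+ 2) / 2) <=
  #|[set b : {set 'I_n} | 0 < imbalance R b <= J]%SET|%:R.
Proof.
move=> n0 J0.
set W := [set b | _]%SET.
pose Z := [set b : {set 'I_n} | (2 * #|b| == n)%N]%SET.
pose Far := [set b : {set 'I_n} | J < `|imbalance R b|]%SET.
have imbC (b : {set 'I_n}) : imbalance R (~: b)%SET = - imbalance R b.
  by rewrite /imbalance -[n in - n%:R](card_ord n) -(cardsC b) natrD; lra.
have cover : ([set: {set 'I_n}] \subset (W :|: [set (~: b)%SET | b in W]) :|:
  (Z :|: Far))%SET.
  apply/fintype.subsetP => b _; rewrite !inE.
  have [|Jb] := ltP J; rewrite ?orbT// orbF.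
  have [b0|b0|b0] := ltgtP 0 (imbalance R b).
  - by rewrite (le_trans (ler_norm _) Jb).
  - apply/orP; left; apply/orP; right; apply/imsetP; exists (~: b)%SET;
    last by rewrite finset.setCK.
    rewrite inE imbC oppr_gt0 b0/=; apply: le_trans Jb.
    by rewrite -normrN ler_norm.
  - apply/orP; right; rewrite -(eqr_nat R) natrM; apply/eqP; move: b0;
    rewrite /imbalance; lra.
have c1 : (2 ^ n <= (#|W| + #|W|) + (#|Z| + #|Far|))%N.
  rewrite -(card_subsets n) -cardsT (leq_trans (subset_leq_card cover))//.
  rewrite (leq_trans (leq_card_setU _ _))// leq_add//.
    by rewrite (leq_trans (leq_card_setU _ _))// leq_add2l leq_imset_card.
  by rewrite (leq_trans (leq_card_setU _ _)).
have c2 : 2 ^+ n <= #|W|%:R + #|W|%:R + (#|Z|%:R + #|Far|%:R) :> R.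
  by rewrite -natrX -!natrD ler_nat.
have sn0 : 0 < Num.sqrt n%:R :> R by rewrite sqrtr_gt0 ltr0n.
have c3 : #|Z|%:R <= 2 ^+ n * (Num.sqrt n%:R)^-1 :> R.
  rewrite ler_pdivlMr// -(@ler_sqr R) ?nnegrE ?mulr_ge0 ?exprn_ge0 ?(ltW sn0)//.
  rewrite exprMn sqr_sqrtr// -!natrX -natrM ler_nat.
  have -> : ((2 ^ n) ^ 2 = 4 ^ n)%N by rewrite -expnM mulnC expnM.
  exact: card_balanced.
have c4 : #|Far|%:R <= 2 ^+ n * (n%:R / J ^+ 2) :> R.
  rewrite mulrA ler_pdivlMr ?exprn_gt0// mulrC [leRHS]mulrC.
  exact: card_far (ltW J0).
lra.
Qed.

(** Change of measure from fair trials to trials of success probability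
    1/2 - u: with k successes the density is
    (1 - 4 u^2)^(n - k) (1 - 2 u)^(2 k - n), where 2 k - n is the imbalance. *)
Lemma window_weight n (u : R) j (b : {set 'I_n}) : 0 <= u <= 4^-1 ->
  0 < imbalance R b <= j%:R ->
  2^-1 ^+ n * ((1 - 4 * u ^+ 2) ^+ n * (1 - 2 * u) ^+ j) <=
  (2^-1 - u) ^+ #|b| * (1 - (2^-1 - u)) ^+ (n - #|b|).
Proof.
move=> /andP[u0 u1]; rewrite /imbalance subr_gt0 lerBlDr.
have -> : 2 * #|b|%:R = (2 * #|b|)%:R :> R by rewrite natrM.
rewrite ltr_nat -natrD ler_nat => /andP[nb bj].
have bn : (#|b| <= n)%N by rewrite -[n in (_ <= n)%N]card_ord max_card.
set k := #|b| in nb bj bn *.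
have v0 : 0 <= 1 - 4 * u ^+ 2 <= 1 by apply/andP; split; nra.
have w0 : 0 <= 1 - 2 * u <= 1 by apply/andP; split; lra.
have -> : 2^-1 - u = 2^-1 * (1 - 2 * u) by lra.
have -> : 1 - 2^-1 * (1 - 2 * u) = 2^-1 * (1 + 2 * u) by lra.
rewrite !exprMn mulrACA -exprD subnKC// ler_wpM2l ?exprn_ge0//.
(* the excess i of successes over failures *)
have [i ki] : exists i, k = ((n - k) + i)%N by exists (k - (n - k))%N; lia.
rewrite {1}ki exprD mulrAC -exprMn.
have -> : (1 - 2 * u) * (1 + 2 * u) = 1 - 4 * u ^+ 2 by lra.
case/andP: v0 => v0 v1; case/andP: w0 => w0 w1.
by apply: ler_pM; rewrite ?exprn_ge0//; apply: ler_wiXn2l => //; lia.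
Qed.

Lemma subset_prob_majority_ge n (u : R) j : (0 < n)%N -> (0 < j)%N ->
  0 <= u <= 4^-1 ->
  (1 - 4 * u ^+ 2) ^+ n * (1 - 2 * u) ^+ j *
    ((1 - (Num.sqrt n%:R)^-1 - n%:R / j%:R ^+ 2) / 2) <=
  subset_prob (2^-1 - u) (fun b : {set 'I_n} => (n < 2 * #|b|)%N).
Proof.
move=> n0 j0 u01; have /andP[u0 u1] := u01.
set W := [set b : {set 'I_n} | 0 < imbalance R b <= j%:R]%SET.
apply: (@le_trans _ _ (\sum_(b in W)
    (2^-1 - u) ^+ #|b| * (1 - (2^-1 - u)) ^+ (n - #|b|))); last first.
  rewrite [leRHS](bigID (mem W))/= ler_wpDr//.
    by apply: sumr_ge0 => b _; rewrite mulr_ge0// exprn_ge0//; lra.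
  rewrite le_eqVlt; apply/orP; left; apply/eqP; apply: eq_bigl => b.
  apply/idP/andP => [h|[]//]; split => //.
  move: h; rewrite inE => /andP[]; rewrite /imbalance subr_gt0.
  have -> : 2 * #|b|%:R = (2 * #|b|)%:R :> R by rewrite natrM.
  by rewrite ltr_nat.
apply: (@le_trans _ _ (\sum_(b in W)
    2^-1 ^+ n * ((1 - 4 * u ^+ 2) ^+ n * (1 - 2 * u) ^+ j))); last first.
  by apply: ler_sum => b; rewrite inE; exact: window_weight.
rewrite sumr_const -[leRHS]mulr_natr.
have cW := card_window n0 (_ : 0 < j%:R :> R); rewrite ltr0n in cW;
  have {cW} := cW j0.
rewrite -/W => cW.
have h : ((1 - (Num.sqrt n%:R)^-1 - n%:R / j%:R ^+ 2) / 2) <= 2^-1 ^+ n *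
  #|W|%:R :> R.
  by rewrite exprVn ler_pdivlMl ?exprn_gt0.
have h2 : 0 <= (1 - 4 * u ^+ 2) ^+ n * (1 - 2 * u) ^+ j.
  by rewrite mulr_ge0// exprn_ge0//; nra.
by apply: le_trans (ler_wpM2l h2 h) _; rewrite mulrCA mulrA.
Qed.

(** The window of [subset_prob_majority_ge] is taken of length about A sqrt n:
    this is long enough to capture nearly half of the fair samples, and short
    enough for the change of measure to cost a constant factor only. *)
Lemma majority_tail n (A t : R) : (0 < n)%N -> 1 <= A -> 0 <= t ->
  t / Num.sqrt n%:R <= 4^-1 -> (Num.sqrt n%:R)^-1 + (A ^+ 2)^-1 <= 1 ->
  expR (- (8 * t ^+ 2 + 4 * t * (A + 1))) *
    ((1 - (Num.sqrt n%:R)^-1 - (A ^+ 2)^-1) / 2) <=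
  subset_prob (2^-1 - t / Num.sqrt n%:R) (fun b : {set 'I_n} => (n < 2 *
    #|b|)%N).
Proof.
move=> n0 A1 t0; set s := Num.sqrt _ => tn An.
have n1 : (1 : R) <= n%:R by rewrite ler1n.
have s1 : 1 <= s by rewrite -[leLHS]sqrtr1 ler_wsqrtr.
have s2 : s ^+ 2 = n%:R by rewrite sqr_sqrtr.
set u := t / s.
have us : u * s = t by rewrite /u mulfVK// gt_eqF//; lra.
have u0 : 0 <= u by rewrite divr_ge0//; lra.
have u1 : u <= 4^-1 by exact: tn.
have As0 : 0 <= A * s by rewrite mulr_ge0//; lra.
(* the window has to be an integer, between A sqrt n and (A + 1) sqrt n *)
pose j := (Num.truncn (A * s)).+1.
have /andP[jl jr] : A * s <= j%:R <= A * s + 1.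
  have /andP[h1 h2] := truncn_itv As0.
  by rewrite /j (ltW h2)/= -natr1 lerD2r.
apply: le_trans (subset_prob_majority_ge (j := j) n0 _ _) => //;
  last by rewrite u0.
have e1 : expR (- (8 * t ^+ 2)) <= (1 - 4 * u ^+ 2) ^+ n.
  apply: le_trans (expR_onem_expn_le n _); last by apply/andP; split; nra.
  by rewrite ler_expR lerN2 -s2 -us; lra.
have e2 : expR (- (4 * t * (A + 1))) <= (1 - 2 * u) ^+ j.
  apply: le_trans (expR_onem_expn_le j _); last by apply/andP; split; lra.
  rewrite ler_expR lerN2 -us; have : j%:R <= (A + 1) * s by lra.
  by move/(ler_wpM2l u0); lra.
have e3 : n%:R / j%:R ^+ 2 <= (A ^+ 2)^-1.
  rewrite ler_pdivrMr ?exprn_gt0// ler_pdivlMl ?exprn_gt0//; last lra.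
  rewrite -s2 -exprMn lerXn2r// nnegrE; lra.
have -> : - (8 * t ^+ 2 + 4 * t * (A + 1)) = - (8 * t ^+ 2) - 4 * t * (A + 1)
  by lra.
rewrite expRD; apply: ler_pM; rewrite ?mulr_ge0 ?expR_ge0//; [lra| |lra].
by apply: ler_pM; rewrite ?expR_ge0.
Qed.

End MajorityTail.

(** * Dominating vertices on a segment *)

Definition dominating n (G : sgraph n) : {set 'I_n} :=
  [set i | [forall j, (i != j) ==> adj G i j]]%SET.

Definition majority n (b : {set 'I_n}) := (n < 2 * #|b|)%N.

Definition majority_dominating_set n : set (sgraph n) :=
  [set G | majority (dominating G)].

Lemma majority_dominating_iso n (G H : sgraph n) : sgraph_iso G H ->
  majority_dominating_set G -> majority_dominating_set H.
Proof.
move=> [s sGH]; rewrite /majority_dominating_set /majority/= => h.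
apply: leq_trans h _; rewrite leq_mul2l /=.
rewrite -(card_imset (dominating G) (@perm_inj _ s)); apply: subset_leq_card.
apply/fintype.subsetP => _ /imsetP[i + ->]; rewrite !inE => /forallP Gi.
apply/forallP => j; rewrite -(permKV s j) sGH (inj_eq perm_inj); exact: Gi.
Qed.

Definition majority_dominating : graph_property :=
  GraphProperty majority_dominating_iso.

Lemma increasing_majority_dominating : increasing majority_dominating.
Proof.
move=> n G G' GG'; rewrite /= /majority_dominating_set /majority/= => h.
apply: leq_trans h _; rewrite leq_mul2l /=; apply: subset_leq_card.
apply/fintype.subsetP => i; rewrite !inE => /forallP Gi; apply/forallP => j.
by apply/implyP => /(implyP (Gi j)); exact: GG'.
Qed.

Section Line.
Variables (R : realType) (n : nat).
Notation point := (1.-tuple (measurableTypeR R)).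
Notation F r := (points_law R 1 n [set x | majority_dominating n (geom_graph x
  r)]).
Notation coord x i := (tnth (tnth x i) ord0).

Lemma eucl_dist1 (x y : 1.-tuple R) : eucl_dist x y = `|tnth x ord0 - tnth y
  ord0|.
Proof. by rewrite /eucl_dist big_ord1 sqrtr_sqr. Qed.

Lemma measurable_majority_dominating (r : R) :
  measurable [set x : n.-tuple point | majority_dominating n (geom_graph x r)].
Proof. exact: measurable_geom_graph. Qed.

(** The points of the segment that are at distance at most r from all of
    [0, 1], when r is at least 1/2. *)
Definition middle (r : R) : set point := tuple_pow 1 `[1 - r, r]%classic.

Lemma measurable_middle r : measurable (middle r).
Proof. exact: measurable_tuple_pow. Qed.

Lemma prob_middle r : 2^-1 <= r <= 1 -> uniform_cube R 1 (middle r) = (2 * r -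
  1)%:E.
Proof.
move=> /andP[r0 r1].
have h : uniform_prob (@ltr01 R) `[1 - r, r]%classic = (2 * r - 1)%:E.
  by rewrite uniform01_itv; [congr EFin; lra|lra..].
by rewrite /uniform_cube /middle (@iid_prob_pow _ _ _ _ _ _ (2 * r - 1)).
Qed.

Lemma prob_majority_middle (r : R) (S : {set 'I_n} -> bool) : 2^-1 <= r <= 1 ->
  points_law R 1 n [set x | S [set i | tnth x i \in middle r]%SET] =
  (subset_prob (2 * r - 1) S)%:E.
Proof. by move=> r01; apply: prob_pattern;
  [exact: measurable_middle|exact: prob_middle]. Qed.

Lemma measurable_pattern (B : set point) (S : {set 'I_n} -> bool) : measurable
  B ->
  measurable [set x : n.-tuple point | S [set i | tnth x i \in B]%SET].
Proof.
move=> mB.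
rewrite (_ : [set x | _] = [set x | exists b : {set 'I_n},
    ([set x : n.-tuple point | S b] `&`
     [set x | forall i, (if i \in b then B else ~` B) (tnth x i)]) x]).
  apply: measurable_exists_fin => b; apply: measurableI.
    by case: (S b); [rewrite (_ : [set x | _] = setT)|rewrite (_ : [set x | _]
      = set0)];
      rewrite ?predeqE.
  apply: (@measurable_box _ _ n (fun i => if i \in b then B else ~` B)) => i.
  by case: ifP => // _; exact: measurableC.
apply/seteqP; split => x /=.
  move=> Sx; exists [set i | tnth x i \in B]%SET; split => // i; rewrite inE.
  by case: ifPn => [/set_mem//|]; rewrite notin_setE.
move=> [b [Sb xb]]; rewrite (_ : [set i | _]%SET = b)//.
apply/setP => i; rewrite inE; have := xb i; case: (i \in b) => h;
  by [rewrite mem_set|rewrite memNset].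
Qed.

Lemma prob_majority_dominating_ge (r : R) : 2^-1 <= r <= 1 ->
  ((subset_prob (2 * r - 1) (@majority n))%:E <= F r)%E.
Proof.
move=> r01; rewrite -prob_majority_middle//.
apply: (le_prob_ae (B := @in_cube R 1 n)).
- by apply: measurable_pattern; exact: measurable_middle.
- exact: measurable_in_cube.
- exact: measurable_majority_dominating.
- exact: prob_in_cube.
move=> x [h cx] /=; rewrite /majority_dominating_set /=.
apply: leq_trans h _; rewrite leq_mul2l /=; apply: subset_leq_card.
apply/fintype.subsetP => i; rewrite finset.inE => /set_mem Mi;
  rewrite finset.inE.
have [x0 x1] := itvccP (Mi ord0).
apply/forallP => j; apply/implyP => ij; rewrite /= /geom_adj ij/= eucl_dist1.
have [y0 y1] := itvccP (cx j ord0).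
by rewrite ler_norml; apply/andP; split; lra.
Qed.

(** A dominating vertex is within r of the point of the sample in [0, s] and
    of the one in [1 - s, 1], hence lies in the middle part of radius r + s.
    This excludes that a majority of the points lies outside that part, an event
    which has by complementation the probability of a majority at the mirrored
    parameter. *)
Lemma prob_majority_dominating_le (r s : R) : 0 <= s -> 2^-1 <= r -> r + s <= 1
  ->
  (F r <= (1 - subset_prob (2 - 2 * (r + s)) (@majority n) + 2 * (1 - s) ^+
    n)%:E)%E.
Proof.
move=> s0 r0 rs1.
have rs : 2^-1 <= r + s <= 1 by apply/andP; split; lra.
(* the event E below: a majority lies outside the middle part *)
pose S (b : {set 'I_n}) := majority (~: b)%SET.
pose E := [set x : n.-tuple point | S [set i | tnth x i \in middle (r +
  s)]%SET].
have mE : measurable E by apply: measurable_pattern; exact: measurable_middle.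
have PE : points_law R 1 n E = (subset_prob (2 - 2 * (r + s)) (@majority n))%:E.
  rewrite prob_majority_middle// subset_probC; congr (subset_prob _ _)%:E; lra.
pose H (B : set (measurableTypeR R)) : set (n.-tuple point) :=
  tuple_pow n (~` tuple_pow 1 B).
have mH B : measurable B -> measurable (H B).
  move=> mB; apply: measurable_tuple_pow; apply: measurableC;
    exact: measurable_tuple_pow.
have PH B : measurable B -> uniform_prob (@ltr01 R) B = s%:E ->
    points_law R 1 n (H B) = ((1 - s) ^+ n)%:E.
  move=> mB Bs; rewrite /points_law /H (@iid_prob_pow _ _ _ _ _ _ (1 - s))//.
    by apply: measurableC; exact: measurable_tuple_pow.
  rewrite probability_setC; last exact: measurable_tuple_pow.
  by rewrite /uniform_cube (@iid_prob_pow _ _ _ _ _ _ s) ?EFinB.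
pose B0 : set (measurableTypeR R) := `[0, s]%classic.
pose B1 : set (measurableTypeR R) := `[1 - s, 1]%classic.
have mB0 : measurable B0 by exact: measurable_itv.
have mB1 : measurable B1 by exact: measurable_itv.
have mH01 : measurable (H B0 `|` H B1) by apply: measurableU; exact: mH.
apply: (@le_trans _ _ (points_law R 1 n (~` E `|` (H B0 `|` H B1)))).
  apply: le_prob.
  - exact: measurable_majority_dominating.
  - by apply: measurableU => //; exact: measurableC.
  move=> x; rewrite /= /majority_dominating_set /= => dx.
  have [H0|/existsNP[i /contrapT xi]] := pselect (H B0 x); first by right; left.
  have [H1|/existsNP[j /contrapT xj]] := pselect (H B1 x); first by right;
    right.
  left; rewrite /E /= /S; apply/negP; rewrite /majority -leqNgt.
  set b := [set i | _]%SET.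
  have db : (#|dominating (geom_graph x r)| <= #|b|)%N.
    apply: subset_leq_card; apply/fintype.subsetP => k;
      rewrite finset.inE => /forallP Dk; rewrite finset.inE.
    have Dk' l : `|coord x k - coord x l| <= r.
      have [->|kl] := eqVneq k l; first by rewrite subrr normr0; lra.
      by have := Dk l; rewrite kl /= /geom_adj kl eucl_dist1.
    have [i0 i1] := itvccP (xi ord0); have [j0 j1] := itvccP (xj ord0).
    have := Dk' i; have := Dk' j;
      rewrite !ler_norml => /andP[h1 h2] /andP[h3 h4].
    rewrite mem_set// => l; rewrite ord1 /= in_itv/=; apply/andP; split; lra.
  move: (cardsC b) dx db; rewrite card_ord /majority.
  by move: #|b| #|(~: b)%SET| #|dominating _| => p q m; lia.
apply: le_trans (measureU2 _ _ _) _ => //; first exact: measurableC.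
apply: (@le_trans _ _ ((1 - subset_prob (2 - 2 * (r + s)) (@majority n))%:E +
   (2 * (1 - s) ^+ n)%:E)%E); last by rewrite -EFinD.
apply: leeD; first by rewrite [leLHS]probability_setC// PE EFinB.
apply: le_trans (measureU2 _ _ _) _; [exact: mH|exact: mH|].
rewrite [X in (X + _)%E]PH//; last by rewrite uniform01_itv//; [congr EFin;
  lra|lra..].
rewrite [X in (_ + X)%E]PH//; last by rewrite uniform01_itv//; [congr EFin;
  lra|lra..].
by rewrite -EFinD lee_fin; lra.
Qed.

Lemma prob_majority_dominating_diam : (0 < n)%N -> F (Num.sqrt (1%:R : R)) =
  1%:E.
Proof.
move=> n0; apply/eqP; rewrite eq_le; apply/andP; split.
  by apply: probability_le1; exact: measurable_majority_dominating.
rewrite -(prob_complete_diam R 1 n); apply: le_prob.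
- exact: measurable_complete.
- exact: measurable_majority_dominating.
move=> x cx /=; rewrite /majority_dominating_set /= /majority.
rewrite (_ : dominating _ = [set: 'I_n]%SET) ?cardsT ?card_ord; first lia.
by apply/setP => i; rewrite !inE; apply/forallP => j; apply/implyP; exact: cx.
Qed.

End Line.

(** * Width of the majority-dominating property *)

Lemma near_sqrt_natr_gt (R : realType) (a : R) :
  \forall n \near \oo, a < Num.sqrt n%:R.
Proof.
near=> n.
have an : a ^+ 2 < n%:R by near: n; exact: nbhs_infty_gtr.
rewrite (le_lt_trans (ler_norm a))// -sqrtr_sqr ltr_sqrt//.
by rewrite (le_lt_trans _ an)// sqr_ge0.
Unshelve. all: by end_near. Qed.

(** The radii compared are 3/4 - u/2 and 3/4 + u/2 - u/4, where the last term
    is the shift s of [prob_majority_dominating_le]; it is a fixed fraction of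
    u, which leaves the width of order u. *)
Lemma width_majority_ge (R : realType) n (e u : R) : (0 < n)%N -> 0 < e < 2^-1
  ->
  0 <= u <= 4^-1 ->
  e + 2 * (1 - u / 4) ^+ n < subset_prob (2^-1 - u) (@majority n) ->
  3 / 4 * u <= width 1 majority_dominating n e.
Proof.
move=> n0 /andP[e0 e1] /andP[u0 u1] h.
have FD := prob_majority_dominating_diam R n0.
have D0 : 0 < Num.sqrt (1%:R : R) by rewrite sqrtr_gt0.
have s1 : 0 <= (1 - u / 4) ^+ n by rewrite exprn_ge0//; lra.
have h1 : threshold 1 majority_dominating n e <= 3 / 4 - u / 2.
  apply: threshold_le; first lra.
  apply: le_trans (prob_majority_dominating_ge n _); last by apply/andP;
    split; lra.
  have -> : 2 * (3 / 4 - u / 2) - 1 = 2^-1 - u by lra.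
  by rewrite lee_fin; lra.
have h2 : 3 / 4 + u / 4 <= threshold 1 majority_dominating n (1 - e).
  apply: (le_threshold increasing_majority_dominating D0).
    by rewrite FD lee_fin; lra.
  apply: le_lt_trans (prob_majority_dominating_le n (s := u / 4) _ _ _) _;
    [lra..|].
  have -> : 2 - 2 * (3 / 4 + u / 4 + u / 4) = 2^-1 - u by lra.
  by rewrite lte_fin; lra.
by rewrite /width; lra.
Qed.

(** Write e = exp (- L) with L at least L0 > ln 2. The exponent is split: a
    fraction th of it is kept such that w = exp (- th L0) is still below 1/2,
    and the rest pays for the change of measure in [majority_tail], where the
    choices of B and c keep the exponent below (1 - th) L. The number k is
    half of the gap between w and 1/2; by the choice of A it absorbs, for n
    large, the losses of [card_window], and what remains of the gap absorbs the
    probability that an end of the segment is empty, which vanishes as n grows.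
      *)
Lemma width_majority_dominating (R : realType) :
  @width_Omega R 1 majority_dominating (fun (n : nat) (eps : R) =>
    Num.sqrt (ln eps^-1) / Num.sqrt n%:R).
Proof.
move=> e0 /andP[e00 e01].
pose ell e : R := ln e^-1.
have expL e : 0 < e -> expR (- ell e) = e.
  by move=> ep; rewrite /ell lnV ?posrE// opprK lnK ?posrE.
set L0 := ell e0.
have L02 : ln 2 < L0.
  rewrite ltr_ln ?posrE ?invr_gt0//.
  by rewrite -[ltLHS]invrK ltf_pV2 ?posrE ?invr_gt0.
have ln2 : 0 < ln 2 :> R by rewrite ln_gt0// ltr1n.
pose th : R := (L0 + ln 2) / (2 * L0).
have thL0 : th * L0 = (L0 + ln 2) / 2.
  rewrite /th invfM; have : L0^-1 * L0 = 1 by rewrite mulVf// gt_eqF//; lra.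
  by move=> LL; rewrite -mulrA -mulrA LL mulr1.
have th0 : 0 < th by rewrite divr_gt0//; lra.
have th1 : th < 1 by rewrite ltr_pdivrMr; lra.
set w := expR (- (th * L0)).
have w2 : w < 2^-1.
  rewrite -[ltRHS]lnK ?posrE ?invr_gt0// ltr_expR lnV ?posrE//; lra.
have w0 : 0 < w by exact: expR_gt0.
pose k : R := (2^-1 - w) / 2.
have k0 : 0 < k by rewrite /k; lra.
have kE : w + k = 2^-1 - k by rewrite /k; lra.
have k4 : k <= 4^-1 by rewrite /k; lra.
pose A : R := 1 + k^-1.
have kV0 : 0 < k^-1 by rewrite invr_gt0.
have A1 : 1 <= A by rewrite /A; lra.
have Ak : (A ^+ 2)^-1 <= k.
  rewrite -[leRHS]invrK lef_pV2 ?posrE ?exprn_gt0//; last lra.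
  by rewrite /A; nra.
pose B : R := 8 + 4 * (A + 1) / Num.sqrt L0.
have sL0 : 0 < Num.sqrt L0 by rewrite sqrtr_gt0; lra.
have B0 : 0 < B by rewrite ltr_wpDr// divr_ge0 ?(ltW sL0)//; lra.
pose c : R := Num.min 1 ((1 - th) / B).
have c0 : 0 < c by rewrite lt_min ltr01 divr_gt0//; lra.
have c1 : c <= 1 by rewrite ge_min lexx.
have cB : c * B <= 1 - th by rewrite -ler_pdivlMr// ge_min lexx orbT.
exists (3 / 4 * c); first by rewrite mulr_gt0.
move=> e /andP[ep ee]; rewrite -/(ell e); set L := ell e.
have LL0 : L0 <= L.
  by rewrite /L0 /L /ell ler_ln ?posrE ?invr_gt0// lef_pV2 ?posrE.
have L0p : 0 < L0 by lra.
set q := Num.sqrt L.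
have q2 : q ^+ 2 = L by rewrite sqr_sqrtr//; lra.
have qL0 : Num.sqrt L0 <= q by rewrite ler_wsqrtr.
have q0 : 0 < q by exact: lt_le_trans qL0.
pose t := c * q.
have t0 : 0 < t by rewrite mulr_gt0.
have exponent : 8 * t ^+ 2 + 4 * t * (A + 1) <= (1 - th) * L.
  have qq : q <= L / Num.sqrt L0.
    by rewrite ler_pdivlMr// -q2 expr2 ler_wpM2l// ltW.
  have h1 : 4 * t * (A + 1) <= c * (4 * (A + 1) / Num.sqrt L0) * L.
    have : c * (4 * (A + 1)) * q <= c * (4 * (A + 1)) * (L / Num.sqrt L0).
      by rewrite ler_wpM2l// mulr_ge0 ?(ltW c0)//; lra.
    by rewrite /t; lra.
  have h2 : 8 * t ^+ 2 <= c * 8 * L.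
    have : c * (c * L) <= 1 * (c * L)
      by rewrite ler_wpM2r// mulr_ge0 ?(ltW c0)//; lra.
    by rewrite /t exprMn q2; lra.
  have h3 : c * B * L <= (1 - th) * L by rewrite ler_wpM2r//; lra.
  by move: h3; rewrite /B; lra.
pose m := expR (- ((1 - th) * L)).
have m0 : 0 < m by exact: expR_gt0.
have em : e <= m * w.
  rewrite -(expL e ep) -/L -expRD ler_expR; nra.
near=> n.
have n0 : (0 < n)%N by near: n; exact: nbhs_infty_gt.
have sk : k^-1 < Num.sqrt n%:R by near: n; exact: near_sqrt_natr_gt.
have st : 4 * t < Num.sqrt n%:R by near: n; exact: near_sqrt_natr_gt.
(* this bound on n makes 2 / (1 + n u / 4) smaller than m k, where n u is
   t sqrt n: the ends of the segment are then rarely empty *)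
have sm : 8 / (m * k * t) < Num.sqrt n%:R by near: n; exact: near_sqrt_natr_gt.
set s := Num.sqrt n%:R in sk st sm *.
have s0 : 0 < s by rewrite sqrtr_gt0 ltr0n.
have s2 : s ^+ 2 = n%:R by rewrite sqr_sqrtr.
have sk' : s^-1 <= k by rewrite -[leRHS]invrK lef_pV2 ?posrE// ltW.
set u := t / s.
have u0 : 0 < u by rewrite divr_gt0.
have u1 : u <= 4^-1 by rewrite ler_pdivrMr//; lra.
have us : u * s = t by rewrite /u mulfVK// gt_eqF.
have tail := majority_tail n0 A1 (ltW t0) u1 _.
have {}tail : m * (w + k) <= subset_prob (2^-1 - u) (@majority n).
  apply: le_trans (tail _); last by rewrite -/s; clear -sk' Ak k4; lra.
  apply: ler_pM; rewrite ?expR_ge0// ?(addr_ge0 (ltW w0) (ltW k0))//.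
    by rewrite ler_expR lerN2.
  by rewrite -/s kE; clear -sk' Ak; lra.
have small : 2 * (1 - u / 4) ^+ n < m * k.
  have v01 : 0 <= u / 4 <= 1 by apply/andP; split; lra.
  have := onem_expn_le n v01.
  have -> : n%:R * (u / 4) = t * s / 4 by rewrite -s2 -us; lra.
  set p := (1 - u / 4) ^+ n => hp.
  have p0 : 0 <= p by rewrite exprn_ge0//; lra.
  have mk : 0 < m * k := mulr_gt0 m0 k0.
  have mkt : 0 < m * k * t := mulr_gt0 mk t0.
  have h8 : 8 < s * (m * k * t) by rewrite -ltr_pdivrMr.
  have [//|bad] := ltP (2 * p) (m * k); exfalso.
  have : m * k * (1 + t * s / 4) <= 2 * p * (1 + t * s / 4).
    have ts : 0 <= t * s := mulr_ge0 (ltW t0) (ltW s0).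
    by rewrite ler_wpM2r//; lra.
  lra.
have := @width_majority_ge R n e u n0; rewrite -/u.
have -> : 3 / 4 * c * (q / s) = 3 / 4 * u by rewrite /u /t; lra.
apply; [by apply/andP; split; lra|by apply/andP; split; lra|].
by move: tail; lra.
Unshelve. all: by end_near. Qed.

Theorem theorem1p2 (R : realType) :
  (forall d : nat, (2 <= d)%N ->
     exists2 A : graph_property, increasing A &
       width_Omega d A (fun (n : nat) (eps : R) =>
         ln eps^-1 `^ d%:R^-1 * n%:R `^ (- d%:R^-1)))
  /\
  (exists2 A : graph_property, increasing A &
     width_Omega 1 A (fun (n : nat) (eps : R) =>
       Num.sqrt (ln eps^-1) / Num.sqrt n%:R)).
Proof.
split=> [d d2|].
  exists complete; first exact: increasing_complete.
  by apply: width_complete; exact: ltnW.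
exists majority_dominating; first exact: increasing_majority_dominating.
exact: width_majority_dominating.
Qed.
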